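(* Let $(x_{0:K},y_{1:K})$ follow the linear Gaussian state-space model described in the context and let $k\in\{1,\dots,K\}$. Suppose that $$p(x_0\mid x_{k-1},y_{1:k-2}) = \mathcal{N}\big(G_{0\mid k-1}x_{k-1}+p_{0\mid k-1},\ L_{0\mid k-1}(L_{0\mid k-1})^\top\big),$$ $$p(x_{k-1}\mid x_k,y_{1:k-1}) = \mathcal{N}\big(\Gamma_k x_k+\pi_k,\ \Lambda_k(\Lambda_k)^\top\big),$$ for given $G_{0\mid k-1},\Gamma_k, L_{0\mid k-1},\Lambda_k\in\mathbb{R}^{D\times D}$ and $p_{0\mid k-1},\pi_k\in\mathbb{R}^D$ (where $p_{0\mid k-1}$ and $\pi_k$ may depend measurably on the observations conditioned on). Let $$\mathfrak{Q}\,\mathfrak{R}=\begin{pmatrix}(\Lambda_k)^\top (G_{0\mid k-1})^\top\\ (L_{0\mid k-1})^\top\end{pmatrix}\in\mathbb{R}^{2D\times D}$$ be a (reduced) QR decomposition, i.e. $\mathfrak{Q}\in\mathbb{R}^{2D\times D}$ satisfies $\mathfrak{Q}^\top\mathfrak{Q}=I_D$ and $\mathfrak{R}\in\mathbb{R}^{D\times D}$ is upper triangular. Then $$p(x_0\mid x_k,y_{1:k-1})=\mathcal{N}\big(G_{0\mid k}x_k+p_{0\mid k},\ L_{0\mid k}(L_{0\mid k})^\top\big),$$ where $$G_{0\mid k}=G_{0\mid k-1}\Gamma_k,\qquad p_{0\mid k}=G_{0\mid k-1}\pi_k+p_{0\mid k-1},\qquad L_{0\mid k}=\mathfrak{R}^\top.$$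 Moreover, computing $(G_{0\mid k},p_{0\mid k},L_{0\mid k})$ from $(G_{0\mid k-1},p_{0\mid k-1},L_{0\mid k-1})$ and $(\Gamma_k,\pi_k,\Lambda_k)$ in this way costs $\mathcal{O}(D^3)$ floating-point operations.
   Context: State-space model. Let $d, D, K\ge 1$ be integers, $A_1,\dots,A_K\in\mathbb{R}^{D\times D}$, $H_1,\dots,H_K\in\mathbb{R}^{d\times D}$, $m_{0\mid 0}\in\mathbb{R}^D$, and let $C_{0\mid 0},B_1,\dots,B_K\in\mathbb{R}^{D\times D}$ and $R_1,\dots,R_K\in\mathbb{R}^{d\times d}$ be covariance matrices (symmetric positive semidefinite, possibly singular). The random variables are $$x_0=\theta,\qquad x_k = A_kx_{k-1}+b_k,\qquad y_k = H_kx_k + r_k,\qquad k=1,\dots,K,$$ with mutually independent $\theta\sim\mathcal{N}(m_{0\mid 0},C_{0\mid 0})$, $b_k\sim\mathcal{N}(0,B_k)$, $r_k\sim\mathcal{N}(0,R_k)$, $k=1,\dots,K$. Notation. $y_{1:k}=\{y_1,\dots,y_k\}$, with the convention $y_{1:-1}=y_{1:0}=\emptyset$. $p(u\mid v)$ denotes the (regular) conditional distribution of $u$ given $v$; equalities of conditional distributions hold almost surely with respect to the law of the conditioning variables. $p(x_0\mid x_0)$ is the point mass at $x_0$. $\mathcal{N}(m,C)$ is the Gaussian distribution with mean $m$ and possibly singular covariance $C$. A generalised Cholesky factor of a covariance matrix $\Sigma$ is any matrix $L$ with $\Sigma=LL^\top$ (so $L_{0\mid k-1}$, $\Lambda_k$,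 $L_{0\mid k}$ are generalised Cholesky factors of the respective conditional covariances). The symbols $p_{0\mid k}$ with subscripts denote vectors, not densities. *)

(* Defs.v *)
From HB Require Import structures.
From mathcomp Require Import all_boot all_order all_algebra.
From mathcomp Require Import all_classical all_reals all_analysis.
Set Implicit Arguments.
Unset Strict Implicit.
Unset Printing Implicit Defensive.
Import Order.TTheory GRing.Theory Num.Theory.
Import numFieldNormedType.Exports.

Local Open Scope classical_set_scope.
Local Open Scope ring_scope.

(* R^n with the sigma-algebra generated by the coordinates, i.e. the Borel
   sets; this follows the library's instance on n.-tuple T. *)
Section measurable_cV.
Context {R : realType} {n : nat}.

Let coors (i : 'I_n) (u : 'cV[R]_n) : R := u i 0.

Let cV_set0 : g_sigma_preimage coors set0.
Proof. exact: sigma_algebra0. Qed.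

Let cV_setC A : g_sigma_preimage coors A -> g_sigma_preimage coors (~` A).
Proof. exact: sigma_algebraC. Qed.

Let cV_bigcup (F : (set 'cV[R]_n)^nat) :
  (forall i, g_sigma_preimage coors (F i)) ->
  g_sigma_preimage coors (\bigcup_i (F i)).
Proof. exact: sigma_algebra_bigcup. Qed.

HB.instance Definition _ := @isMeasurable.Build default_measure_display
  'cV[R]_n (g_sigma_preimage coors) cV_set0 cV_setC cV_bigcup.

End measurable_cV.

Section gaussian.
Context {R : realType}.

(* Variance 0 must be treated apart: the library's [normal_prob m 0] is not the
   point mass at m. Note also that [normal_prob] takes a standard deviation. *)
Definition normal1 (m v : R) : set R -> \bar R :=
  if v == 0 then \d_m else normal_prob m (Num.sqrt v).

Definition is_covariance {n} (C : 'M[R]_n) : Prop :=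
  C^T = C /\ forall a : 'cV[R]_n, 0 <= (a^T *m C *m a) 0 0.

(* mu = N(m, C), C possibly singular: every linear form a^T u has the
   (possibly degenerate) univariate law N(a^T m, a^T C a). *)
Definition is_gaussian {n} (mu : set 'cV[R]_n -> \bar R)
    (m : 'cV[R]_n) (C : 'M[R]_n) : Prop :=
  forall (a : 'cV[R]_n) (A : set R), measurable A ->
    pushforward mu (fun u : 'cV[R]_n => (a^T *m u) 0 0) A =
    normal1 ((a^T *m m) 0 0) ((a^T *m C *m a) 0 0) A.

End gaussian.

(* The restriction of y_{1:n} to y_{1:n-1} (empty if n = 0). *)
Definition obs_prev {U : Type} {n : nat} (ys : n.-tuple U) : n.-1.-tuple U :=
  [tuple tnth ys (widen_ord (leq_pred n) i) | i < n.-1].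

Section joint_variables.
Context {d d1 d2 : measure_display} {T : measurableType d}
  {U : measurableType d1} {V : measurableType d2}.

Definition rv_pair (u : {mfun T >-> U}) (v : {mfun T >-> V}) : T -> U * V :=
  fun w => (u w, v w).

(* y_{1:n}; the process y is indexed from 1. *)
Definition obs_upto (y : nat -> {mfun T >-> U}) (n : nat) : T -> n.-tuple U :=
  fun w => [tuple y i.+1 w | i < n].

Let measurable_rv_pair (u : {mfun T >-> U}) (v : {mfun T >-> V}) :
  measurable_fun [set: T] (rv_pair u v).
Proof. exact: measurable_fun_pair. Qed.

HB.instance Definition _ (u : {mfun T >-> U}) (v : {mfun T >-> V}) :=
  isMeasurableFun.Build _ _ _ _ (rv_pair u v) (@measurable_rv_pair u v).

Let measurable_obs_upto (y : nat -> {mfun T >-> U}) n :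
  measurable_fun [set: T] (obs_upto y n).
Proof.
apply/measurable_fun_tnthP => i.
rewrite (_ : _ \o _ = y i.+1); first exact: measurable_funPT.
by apply/funext => w /=; rewrite tnth_mktuple.
Qed.

HB.instance Definition _ (y : nat -> {mfun T >-> U}) n :=
  isMeasurableFun.Build _ _ _ _ (obs_upto y n) (@measurable_obs_upto y n).

End joint_variables.

Section conditional_laws.
Context {R : realType} {d : measure_display} {T : measurableType d}
  (P : probability T R).

(* kappa is a regular conditional distribution of u given v. *)
Definition is_cond_law {d1 d2} {U : measurableType d1} {V : measurableType d2}
    (u : {RV P >-> U}) (v : {RV P >-> V}) (kappa : R.-pker V ~> U) : Prop :=
  forall (A : set U) (B : set V), measurable A -> measurable B ->
    P (u @^-1` A `&` v @^-1` B) =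
    (\int[distribution P v]_(z in B) kappa z A)%E.

(* p(u | x, y) = N(G x + p(y), L L^T), almost surely with respect to the law
   of (x, y). *)
Definition cond_gaussian {m n : nat} {d2} {V : measurableType d2}
    (u : {RV P >-> 'cV[R]_m}) (x : {RV P >-> 'cV[R]_n}) (y : {RV P >-> V})
    (G : 'M[R]_(m, n)) (p : V -> 'cV[R]_m) (L : 'M[R]_m) : Prop :=
  exists kappa : R.-pker ('cV[R]_n * V)%type ~> 'cV[R]_m,
    is_cond_law u (rv_pair x y) kappa /\
    {ae distribution P (rv_pair x y), forall z,
      is_gaussian (kappa z) (G *m z.1 + p z.2) (L *m L^T)}.

Definition mutually_independent {I : finType} (F : I -> set (set T)) : Prop :=
  forall (J : {set I}) (E : I -> set T), (forall i, i \in J -> F i (E i)) ->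
    P (\bigcap_(i in [set` J]) E i) = (\prod_(i in J) P (E i))%E.

Definition sigma_of {d1} {U : measurableType d1} (u : {RV P >-> U}) :
  set (set T) := preimage_set_system [set: T] u measurable.

(* The sigma-algebras of theta, b_1, ..., b_K, r_1, ..., r_K; the ordinal j
   stands for the time index j + 1. *)
Definition noise_sigma {nx ny : nat} (K : nat) (theta : {RV P >-> 'cV[R]_nx})
    (b : nat -> {RV P >-> 'cV[R]_nx}) (r : nat -> {RV P >-> 'cV[R]_ny})
    (i : (unit + ('I_K + 'I_K))%type) : set (set T) :=
  match i with
  | inl _ => sigma_of theta
  | inr (inl j) => sigma_of (b j.+1)
  | inr (inr j) => sigma_of (r j.+1)
  end.

(* All families are indexed by nat, but only the indices 1, ..., K
   (0, ..., K for x) are constrained. *)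
Record linear_gaussian_ssm {nx ny : nat} (K : nat)
    (A : nat -> 'M[R]_nx) (H : nat -> 'M[R]_(ny, nx))
    (m0 : 'cV[R]_nx) (C0 : 'M[R]_nx)
    (B : nat -> 'M[R]_nx) (S : nat -> 'M[R]_ny)
    (theta : {RV P >-> 'cV[R]_nx})
    (b : nat -> {RV P >-> 'cV[R]_nx}) (r : nat -> {RV P >-> 'cV[R]_ny})
    (x : nat -> {RV P >-> 'cV[R]_nx}) (y : nat -> {RV P >-> 'cV[R]_ny}) :
    Prop := {
  ssm_covC0 : is_covariance C0 ;
  ssm_covB : forall k, (1 <= k <= K)%N -> is_covariance (B k) ;
  ssm_covS : forall k, (1 <= k <= K)%N -> is_covariance (S k) ;
  ssm_theta : is_gaussian (distribution P theta) m0 C0 ;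
  ssm_b : forall k, (1 <= k <= K)%N -> is_gaussian (distribution P (b k)) 0 (B k) ;
  ssm_r : forall k, (1 <= k <= K)%N -> is_gaussian (distribution P (r k)) 0 (S k) ;
  ssm_indep : mutually_independent (noise_sigma (K := K) theta b r) ;
  ssm_x0 : forall w, x 0%N w = theta w ;
  ssm_x : forall k, (1 <= k <= K)%N ->
    forall w, x k w = A k *m x k.-1 w + b k w ;
  ssm_y : forall k, (1 <= k <= K)%N ->
    forall w, y k w = H k *m x k w + r k w
}.

End conditional_laws.

Definition reduced_qr {R : realType} {m n : nat}
    (Q : 'M[R]_(m, n)) (U : 'M[R]_n) (M : 'M[R]_(m, n)) : Prop :=
  [/\ Q^T *m Q = 1%:M, forall i j : 'I_n, (j < i)%N -> U i j = 0 & Q *m U = M].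

(* Programs over the reals, used to count floating-point operations (with exact
   arithmetic). The memory is a list of numbers, initially the input;
   [Compute] appends the result of one operation, [Branch i j p q] continues
   with p if cell i <= cell j and with q otherwise, [Output s] returns the cells
   listed in s. Reading a cell outside the memory yields 0. *)
Inductive flop :=
  | Const of rat
  | Add of nat & nat
  | Sub of nat & nat
  | Mul of nat & nat
  | Div of nat & nat
  | Sqrt of nat.

Inductive program :=
  | Output of seq nat
  | Compute of flop & program
  | Branch of nat & nat & program & program.

Section semantics.
Context {R : realType}.

(* Division by 0 and square roots of negative numbers are errors: the totalised
   operations of the library are not available to programs. *)
Definition eval_flop (f : flop) (mem : seq R) : option R :=
  match f with
  | Const q => Some (ratr q)
  | Add i j => Some (mem`_i + mem`_j)
  | Sub i j => Some (mem`_i - mem`_j)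
  | Mul i j => Some (mem`_i * mem`_j)
  | Div i j => if mem`_j == 0 then None else Some (mem`_i / mem`_j)
  | Sqrt i => if mem`_i < 0 then None else Some (Num.sqrt mem`_i)
  end.

(* The output and the number of executed operations, comparisons included. *)
Fixpoint run (p : program) (mem : seq R) : option (seq R * nat) :=
  match p with
  | Output s => Some ([seq mem`_i | i <- s], 0%N)
  | Compute f q =>
      if eval_flop f mem is Some v then
        if run q (rcons mem v) is Some (out, c) then Some (out, c.+1) else None
      else None
  | Branch i j q1 q2 =>
      if run (if mem`_i <= mem`_j then q1 else q2) mem is Some (out, c)
      then Some (out, c.+1) else None
  end.

(* Row-major list of entries. *)
Definition entries {m n : nat} (M : 'M[R]_(m, n)) : seq R :=
  [seq M i j | i <- enum 'I_m, j <- enum 'I_n].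

End semantics.

(* Main.v *)
(* Conditionally on x_(k-1) and y_(1:k-2), the variable x_0 is independent of
   (x_k, y_(k-1)), because these depend in addition only on the noises b_k and
   r_(k-1). Hence the law of x_0 given (x_k, y_(1:k-1)) is the mixture of
   p(x_0 | x_(k-1), y_(1:k-2)) over p(x_(k-1) | x_k, y_(1:k-1)). Tested against
   a linear form, this mixture is a convolution of two univariate normal laws,
   so it is Gaussian with covariance G Lambda Lambda^T G^T + L L^T, which is
   the Gram matrix of the stacked matrix and therefore equal to Rf^T Rf.

   For the cost, the triangular factor is computed by Givens rotations, one row
   of the stacked matrix after the other; each rotation preserves the sum of
   the squares of the products of the rows with any fixed vector, so the result
   has the Gram matrix of the stacked matrix. Matrices with equal Gram matrices
   differ by an isometry, which yields the orthonormal factor. *)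

(* Singular covariances rule out densities for the vectors, so conditional laws are handled as
   kernels: identities are checked on a generating pi-system and extended by uniqueness of finite
   measures. As Gaussian vectors are defined through linear forms, densities occur only on the real
   line, where zero variances are separate cases. The first hypothesis holds only almost surely for
   the law of (x_(k-1), y_(1:k-2)), whereas the mixture integrates over p(x_(k-1) | x_k, y_(1:k-1))
   with the conditions fixed. The exceptional set must therefore be shown to be null for almost
   every such conditional law. The stacked matrix may be rank deficient, so the orthonormal factor
   cannot be obtained by inverting the triangular one. Only its existence is shown; the program
   computes the triangular factor alone. *)
Require Import Defs.
From Stdlib Require List.
From HB Require Import structures.
From mathcomp Require Import all_boot all_order all_algebra.
From mathcomp Require Import all_classical all_reals all_analysis.
From mathcomp Require Import measurable_realfun zify ring lra.
Set Implicit Arguments.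
Unset Strict Implicit.
Unset Printing Implicit Defensive.
Import Order.TTheory GRing.Theory Num.Theory.
Import numFieldNormedType.Exports.
Local Open Scope classical_set_scope.
Local Open Scope ring_scope.

(** * Gaussian convolution *)

Section gaussian_convolution.
Context {R : realType}.
Local Notation leb := (@lebesgue_measure R).

(** Lebesgue measure is determined by its values on half-open intervals, and a translation preserves
    their length. *)
Lemma integral_lebesgue_shift (f : R -> \bar R) (c : R) :
  measurable_fun [set: R] f -> (forall r, 0 <= f r)%E ->
  (\int[leb]_r f (r + c)%R = \int[leb]_r f r)%E.
Proof.
move=> mf f0.
have mc : measurable_fun [set: R] (fun r : R => r + c : measurableTypeR R).
  exact: measurable_funD.
transitivity (\int[pushforward leb
    ((fun r : R => r + c)%R : R -> measurableTypeR R)]_r f r)%E.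
  by rewrite ge0_integral_pushforward.
apply: eq_measure_integral => //= A mA _.
apply/esym/lebesgue_measure_unique => //= _ [[a b]] _ <-.
rewrite /pushforward/=.
have -> : (fun r : R => r + c) @^-1` `]a, b]%classic = `]a - c, b - c]%classic.
  by apply/seteqP; split => r /=; rewrite !in_itv/= ltrBlDr lerBrDr.
by rewrite !lebesgue_measure_itv/= !lte_fin ltrD2r -!EFinB opprB addrA subrK.
Qed.

Lemma normal_pdf_shift (m c s x : R) : s != 0 ->
  normal_pdf (m + c) s x = normal_pdf m s (x - c).
Proof.
by move=> s0; rewrite !normal_pdfE// /normal_fun; congr (_ * expR _); ring.
Qed.

Lemma normal_prob_shift (m c s : R) (A : set R) : s != 0 -> measurable A ->
  normal_prob m s ((fun t => t + c) @^-1` A) = normal_prob (m + c) s A.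
Proof.
move=> s0 mA; rewrite /normal_prob integral_mkcond [RHS]integral_mkcond/=.
pose g : R -> \bar R := (fun x => (normal_pdf (m + c) s x)%:E) \_ A.
rewrite -[RHS](integral_lebesgue_shift c (f := g)); last 2 first.
- apply: (measurable_restrictT _ mA).1; apply/measurable_EFinP.
  by apply: measurable_funTS; exact: measurable_normal_pdf.
- by move=> r; rewrite /g patchE; case: ifP => // _; rewrite lee_fin normal_pdf_ge0.
apply: eq_integral => x _; rewrite /g !patchE normal_pdf_shift// addrK.
by rewrite (_ : (x \in _) = (x + c \in A))//; apply/idP/idP; rewrite !inE.
Qed.

(* Completing the square in t. *)
Lemma normal_pdf_mul (m c s1 s2 t x : R) : s1 != 0 -> s2 != 0 ->
  let s := Num.sqrt (s1 ^+ 2 + s2 ^+ 2) in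
  normal_pdf m s1 t * normal_pdf (t + c) s2 x =
  normal_pdf (m + c) s x *
  normal_pdf (m + (x - m - c) * (s1 ^+ 2 / s ^+ 2)) (s1 * s2 / s) t.
Proof.
move=> s10 s20 s.
have s1p : 0 < s1 ^+ 2 by rewrite exprn_even_gt0.
have s2p : 0 < s2 ^+ 2 by rewrite exprn_even_gt0.
have sp : 0 < s1 ^+ 2 + s2 ^+ 2 by rewrite addr_gt0.
have s0 : s != 0 by rewrite gt_eqF// sqrtr_gt0.
have sE : s ^+ 2 = s1 ^+ 2 + s2 ^+ 2 by rewrite sqr_sqrtr// ltW.
rewrite !normal_pdfE//; last by rewrite !mulf_neq0// invr_neq0.
rewrite mulrACA [RHS]mulrACA /normal_fun -!expRD; congr (_ * expR _).
  have pi2_ge0 (u : R) : 0 <= u ^+ 2 * pi *+ 2.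
    by rewrite mulrn_wge0// mulr_ge0 ?sqr_ge0// pi_ge0.
  rewrite /normal_peak -!invfM -!sqrtrM//.
  congr (Num.sqrt _)^-1; rewrite expr_div_n exprMn; field.
  exact: s0.
rewrite expr_div_n exprMn sE; field.
by rewrite s10 s20 gt_eqF.
Qed.

(** The density and the Radon-Nikodym derivative agree almost everywhere, having the same integrals
    over measurable sets. The bound by 1 makes f integrable, as the change of variables requires. *)
Lemma integral_normal_prob (m s : R) (f : R -> \bar R) : s != 0 ->
  measurable_fun [set: R] f -> (forall r, 0 <= f r <= 1)%E ->
  (\int[normal_prob m s]_t f t = \int[leb]_t (f t * (normal_pdf m s t)%:E))%E.
Proof.
move=> s0 mf f01.
have dom := normal_prob_dominates m s.
have intf : (normal_prob m s).-integrable [set: R] f.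
  apply/integrableP; split => //.
  apply: (@le_lt_trans _ _ (\int[normal_prob m s]_t cst 1 t)%E).
    apply: ge0_le_integral => //=; first exact: measurableT_comp.
    by move=> t _; have /andP[f0 f1] := f01 t; rewrite gee0_abs.
  by rewrite integral_cst//= mul1e probability_setT ltry.
have mpdf : measurable_fun [set: R] (EFin \o normal_pdf m s).
  by apply/measurable_EFinP; exact: measurable_normal_pdf.
rewrite -(Radon_Nikodym_change_of_variables dom)//=.
apply: ae_eq_integral => //; first exact: emeasurable_funM.
- by apply: emeasurable_funM => //; exact: mpdf.
- apply: ae_eqe_mul2l =>/=; rewrite Radon_NikodymE//=.
  case: cid => /= h [h1 h2 h3]; apply: integral_ae_eq => //=.
  by move=> E _ mE; rewrite -h3.
Qed.

(** Moving the varying mean into the argument leaves one fixed density composed with a measurable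
    map. *)
Lemma measurable_normal_pdf_center (c s : R) : s != 0 ->
  measurable_fun [set: R * R] (fun z => normal_pdf (z.1 + c) s z.2).
Proof.
move=> s0.
have -> : (fun z : R * R => normal_pdf (z.1 + c) s z.2) =
    (fun z => normal_pdf 0 s (z.2 - (z.1 + c))).
  by apply/funext => z; rewrite -normal_pdf_shift// add0r.
apply: measurableT_comp; first exact: measurable_normal_pdf.
by apply: measurable_funB => //; exact: measurable_funD.
Qed.

Lemma normal_probE (m s : R) (A : set R) : measurable A ->
  normal_prob m s A = (\int[leb]_x ((normal_pdf m s x * \1_A x)%R)%:E)%E.
Proof.
move=> mA; rewrite /normal_prob integral_mkcond/=; apply: eq_integral => x _.
by rewrite patchE indicE; case: ifPn => _; rewrite (mulr1, mulr0).
Qed.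

Lemma measurable_normal_prob_center (c s : R) (A : set R) : s != 0 ->
  measurable A -> measurable_fun [set: R] (fun t => normal_prob (t + c) s A).
Proof.
move=> s0 mA; under eq_fun do rewrite normal_probE//.
pose f (z : R * R) := ((normal_pdf (z.1 + c) s z.2 * \1_A z.2)%R)%:E.
suff : measurable_fun [set: R] (fubini_F leb f) by [].
apply: measurable_fun_fubini_tonelli_F => /=; last first.
  by move=> z; rewrite lee_fin mulr_ge0// normal_pdf_ge0.
apply/measurable_EFinP; apply: measurable_funM.
  exact: measurable_normal_pdf_center.
exact: measurableT_comp.
Qed.

Lemma normal_prob_conv (m c s1 s2 : R) (A : set R) : s1 != 0 -> s2 != 0 ->
  measurable A ->
  (\int[normal_prob m s1]_t normal_prob (t + c)%R s2 A =
   normal_prob (m + c) (Num.sqrt (s1 ^+ 2 + s2 ^+ 2)) A)%E.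
Proof.
move=> s10 s20 mA; set s := Num.sqrt _.
pose g (z : R * R) : \bar R :=
  ((normal_pdf m s1 z.1 * normal_pdf (z.1 + c) s2 z.2 * \1_A z.2)%R)%:E.
have mg : measurable_fun [set: R * R] g.
  apply/measurable_EFinP; apply: measurable_funM; last exact: measurableT_comp.
  apply: measurable_funM; last exact: measurable_normal_pdf_center.
  by apply: measurableT_comp; first exact: measurable_normal_pdf.
have g0 z : (0 <= g z)%E.
  by rewrite lee_fin !mulr_ge0// normal_pdf_ge0.
rewrite integral_normal_prob//; last 2 first.
  exact: measurable_normal_prob_center.
  by move=> t; rewrite measure_ge0 probability_le1.
transitivity (\int[leb]_t \int[leb]_x g (t, x))%E.
  apply: eq_integral => t _; rewrite normal_probE// -ge0_integralZr//=.
  - by apply: eq_integral => x _; rewrite /g/= -EFinM mulrC mulrA.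
  - apply/measurable_EFinP; apply: measurable_funM => //.
    exact: measurable_normal_pdf.
  - by move=> x _; rewrite lee_fin mulr_ge0// normal_pdf_ge0.
  - by rewrite lee_fin normal_pdf_ge0.
(* With the order of integration exchanged, [normal_pdf_mul] splits off a normal density in t, which
   integrates to 1. *)
rewrite fubini_tonelli// normal_probE//; apply: eq_integral => x _.
rewrite /g/=; under eq_integral do rewrite normal_pdf_mul// mulrAC EFinM.
rewrite ge0_integralZl//=; last 3 first.
- by apply/measurable_EFinP; exact: measurable_normal_pdf.
- by move=> t _; rewrite lee_fin normal_pdf_ge0.
- by rewrite lee_fin mulr_ge0// normal_pdf_ge0.
by rewrite integral_normal_pdf mule1.
Qed.

Lemma sqrtr_neq0 (v : R) : 0 <= v -> v != 0 -> Num.sqrt v != 0.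
Proof. by move=> v0 vn0; rewrite gt_eqF// sqrtr_gt0 lt_neqAle eq_sym vn0. Qed.

Lemma measurable_normal1_center (c v : R) (A : set R) : measurable A -> 0 <= v ->
  measurable_fun [set: R] (fun t => normal1 (t + c) v A).
Proof.
move=> mA v0; rewrite /normal1; have [_|v_neq0] := eqVneq v 0.
  have mc : measurable_fun [set: R] (fun t : R => t + c).
    exact: measurable_funD.
  apply/measurable_EFinP.
  suff : measurable_fun [set: R] ((\1_A : R -> R) \o (fun t : R => t + c)) by [].
  by apply: measurableT_comp => //; exact: measurable_indic.
by apply: measurable_normal_prob_center => //; exact: sqrtr_neq0.
Qed.

Lemma normal1_ge0 (m v : R) (A : set R) : (0 <= normal1 m v A)%E.
Proof. by rewrite /normal1; case: ifP. Qed.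

(** [normal1] is only a set function, so the integral is taken against a measure that agrees with
    it. A zero first variance gives evaluation at m, a zero second variance a translation; otherwise
    two densities are convolved. *)
Lemma integral_normal1 (mu : {measure set (measurableTypeR R) -> \bar R}) (m c v1 v2 : R)
    (A : set R) : 0 <= v1 -> 0 <= v2 ->
  (forall B, measurable B -> mu B = normal1 m v1 B) -> measurable A ->
  (\int[mu]_t normal1 (t + c)%R v2 A = normal1 (m + c) (v1 + v2) A)%E.
Proof.
move=> v10 v20 muE mA.
have mf := measurable_normal1_center c mA v20.
move: muE; rewrite {1}/normal1; have [->|v1n0] := eqVneq v1 0 => muE.
  transitivity (\int[\d_(m : measurableTypeR R)]_t normal1 (t + c)%R v2 A)%E.
    by apply: eq_measure_integral => B mB _; exact: muE.
  by rewrite integral_dirac// diracT mul1e add0r.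
transitivity (\int[normal_prob m (Num.sqrt v1)]_t normal1 (t + c)%R v2 A)%E.
  by apply: eq_measure_integral => B mB _; exact: muE.
have [->|v2n0] := eqVneq v2 0.
  rewrite /normal1 eqxx addr0 (negbTE v1n0) -normal_prob_shift ?sqrtr_neq0//.
  have mAc : measurable ((fun t : R => t + c) @^-1` A).
    rewrite -[X in measurable X]setTI.
    by apply: (measurable_funD _ _) => //; exact: measurable_cst.
  by rewrite -[X in _ = normal_prob _ _ X]setIT -integral_indic.
rewrite /normal1 (negbTE v2n0) normal_prob_conv ?sqrtr_neq0// !sqr_sqrtr//.
by rewrite gt_eqF// ltr_pwDl// lt_neqAle eq_sym v1n0.
Qed.

End gaussian_convolution.

(** * Kernels, conditional laws and independence *)

Section measurable_vectors.
Context {R : realType} d (T : measurableType d).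

Lemma measurable_coord n (i : 'I_n) :
  measurable_fun [set: 'cV[R]_n] (fun u => u i 0).
Proof.
move=> _ Y mY; rewrite setTI; apply: sub_sigma_algebra => /=.
rewrite -bigcup_seq/=; exists i => /=; first by rewrite mem_index_enum.
by exists Y => //; rewrite setTI.
Qed.

(** Preimages of generators generate the preimage sigma-algebra, so only preimages under single
    coordinates have to be examined. *)
Lemma measurable_fun_cV n (f : T -> 'cV[R]_n) :
  (forall i, measurable_fun [set: T] (fun t => f t i 0)) ->
  measurable_fun [set: T] f.
Proof.
move=> mf _ Y mY; rewrite setTI.
suff : preimage_set_system [set: T] f measurable `<=` measurable.
  by apply; exists Y => //; rewrite setTI.
rewrite -g_sigma_preimage_comp; apply: smallest_sub.
  exact: sigma_algebra_measurable.
case: n => [|n] in f mf Y mY *; first by rewrite big_ord0.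
rewrite -bigcup_mkord_ord; apply: bigcup_sub => i Ii A [B mB <-].
exact: mf.
Qed.

Lemma measurable_fun_mulmx m n (M : 'M[R]_(m, n)) (f : T -> 'cV[R]_n) :
  measurable_fun [set: T] f -> measurable_fun [set: T] (fun t => M *m f t).
Proof.
move=> mf; apply: measurable_fun_cV => i; under eq_fun do rewrite mxE.
apply: measurable_sum => j; apply: measurable_funM => //.
exact: (measurableT_comp (measurable_coord j)).
Qed.

Lemma measurable_fun_addmx n (f g : T -> 'cV[R]_n) :
  measurable_fun [set: T] f -> measurable_fun [set: T] g ->
  measurable_fun [set: T] (fun t => f t + g t).
Proof.
move=> mf mg; apply: measurable_fun_cV => i; under eq_fun do rewrite mxE.
by apply: measurable_funD; exact: (measurableT_comp (measurable_coord i)).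
Qed.

End measurable_vectors.

Lemma measurable_linear_form {R : realType} n (a : 'cV[R]_n) :
  measurable_fun [set: 'cV[R]_n] (fun u => (a^T *m u) 0 0).
Proof.
apply: (measurableT_comp (measurable_coord 0)).
exact: measurable_fun_mulmx.
Qed.

Section kernel_constructions.
Local Open Scope ereal_scope.
Context {R : realType} d1 d2 d3 (V : measurableType d1) (U : measurableType d2)
  (W : measurableType d3).

Section precomposition.
Variables (k : R.-pker V ~> U) (g : W -> V) (mg : measurable_fun [set: W] g).

(** The measurability proof is an argument so that the kernel structures can be attached to the
    term. *)
Definition kprecomp of measurable_fun [set: W] g :
  W -> {measure set U -> \bar R} := fun w => k (g w).

Let measurable_kprecomp A : measurable A ->
  measurable_fun [set: W] (kprecomp mg ^~ A).
Proof. by move=> mA; exact: measurableT_comp (measurable_kernel k A mA) mg. Qed.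

HB.instance Definition _ := isKernel.Build _ _ W U R (kprecomp mg)
  measurable_kprecomp.

Let kprecomp_prob w : kprecomp mg w [set: U] = 1.
Proof. exact: prob_kernel. Qed.

HB.instance Definition _ := Kernel_isProbability.Build _ _ W U R (kprecomp mg)
  kprecomp_prob.

End precomposition.

Section composition.
Variables (l : R.-pker V ~> U) (k : R.-pker (V * U) ~> W).

Definition kmix : V -> {measure set W -> \bar R} := mkcomp l k.

Let measurable_kmix A : measurable A -> measurable_fun [set: V] (kmix ^~ A).
Proof. exact: KCOMP_FINITE_KERNEL.measurable_fun_kcomp_finite. Qed.

HB.instance Definition _ := isKernel.Build _ _ V W R kmix measurable_kmix.

Let kmix_prob v : kmix v [set: W] = 1.
Proof.
rewrite /kmix/= /kcomp; under eq_integral do rewrite prob_kernel.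
by rewrite integral_cst// mul1e prob_kernel.
Qed.

HB.instance Definition _ := Kernel_isProbability.Build _ _ V W R kmix kmix_prob.

Lemma kmixE v A : kmix v A = \int[l v]_u k (v, u) A.
Proof. by []. Qed.

End composition.

End kernel_constructions.

Section disintegration.
Local Open Scope ereal_scope.
Context {R : realType} {d : measure_display} {T : measurableType d}
  (P : probability T R).
Context {d1 d2 : measure_display} {U : measurableType d1} {V : measurableType d2}.

(** Rectangles form a pi-system that generates the product sigma-algebra and contains the whole
    space. *)
Lemma probability_eq_rect (m1 m2 : {measure set (U * V) -> \bar R}) :
  m1 setT < +oo ->
  (forall A B, measurable A -> measurable B -> m1 (A `*` B) = m2 (A `*` B)) ->
  forall E, measurable E -> m1 E = m2 E.
Proof.
move=> m1oo m12 E mE.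
apply: (measure_unique [set A `*` B | A in measurable & B in measurable]
  (fun=> setT)) => //.
- exact: measurable_prod_measurableType.
- move=> _ _ [A mA [B mB <-]] [A' mA' [B' mB' <-]].
  exists (A `&` A'); first exact: measurableI.
  exists (B `&` B'); first exact: measurableI.
  by rewrite setXI.
- by move=> _; exists setT => //; exists setT => //; rewrite setXTT.
- by rewrite bigcup_const.
- by move=> _ [A mA [B mB <-]]; exact: m12.
Qed.

Variables (u : {RV P >-> U}) (v : {RV P >-> V}) (kappa : R.-pker V ~> U).

(* The product of [distribution P v] and kappa, built from kernels with a dummy
   parameter of type unit. *)
Let law_v : R.-pker unit ~> V :=
  kprobability (measurable_cst (distribution P v : pprobability V R)).

Let swap_snd (z : (unit * V) * U) : U * V := (z.2, z.1.2).

Let measurable_swap_snd : measurable_fun [set: (unit * V) * U] swap_snd.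
Proof.
apply: measurable_fun_pair => //.
exact: measurableT_comp measurable_snd measurable_fst.
Qed.

(** Sends z to the law of (w, z), where w is drawn from [kappa z]. *)
Let graph : R.-pker (unit * V) ~> (U * V)%type :=
  kmix (kprecomp kappa measurable_snd) (kdirac measurable_swap_snd).

Let integral_graph (f : U * V -> \bar R) z :
  measurable_fun [set: U * V] f -> (forall z, 0 <= f z) ->
  \int[graph (tt, z)]_p f p = \int[kappa z]_w f (w, z).
Proof.
move=> mf f0; rewrite [LHS]integral_kcomp//; apply: eq_integral => w _.
by rewrite integral_dirac// diracT mul1e.
Qed.

(** Both sides integrate f, one against the composed kernel and one against the joint law of u and
    v; [is_cond_law] says that these two measures agree on rectangles. *)
Lemma cond_law_integral (f : U * V -> \bar R) :
  is_cond_law u v kappa ->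
  measurable_fun [set: U * V] f -> (forall z, 0 <= f z) ->
  \int[distribution P v]_z \int[kappa z]_w f (w, z) = \int[P]_t f (u t, v t).
Proof.
move=> uv mf f0.
transitivity (\int[kmix law_v graph tt]_p f p).
  rewrite [RHS]integral_kcomp//; apply: eq_integral => z _.
  by rewrite integral_graph.
rewrite -[RHS](ge0_integral_distribution (rv_pair u v))//.
apply: eq_measure_integral => E mE _; apply: probability_eq_rect => //.
  by rewrite [X in X < _]prob_kernel ltry.
move=> A B mA mB; rewrite kmixE.
transitivity (P (u @^-1` A `&` v @^-1` B)); last by [].
rewrite uv// [RHS]integral_mkcond/=; apply: eq_integral => z _.
transitivity (\int[graph (tt, z)]_p (\1_(A `*` B) p)%:E).
  by rewrite integral_indic ?setIT//; exact: measurableX.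
rewrite integral_graph; last 2 first.
- by apply/measurable_EFinP/measurable_indic; exact: measurableX.
- by move=> p; rewrite lee_fin.
rewrite patchE; case: ifPn => [/set_mem Bz|/negP Bz].
  rewrite -[in RHS](setIT A) -integral_indic//; apply: eq_integral => w _.
  congr (_%:E); rewrite !indicE; congr (_%:R); congr nat_of_bool.
  by apply/idP/idP => [/set_mem[/= Aw _]|/set_mem Aw]; exact/mem_set.
apply: integral0_eq => w _; rewrite indicE memNset// => -[_ /= Bz'].
by apply: Bz; rewrite inE.
Qed.
End disintegration.

(** * Independence of disjoint blocks *)

Section independence.
Local Open Scope ereal_scope.
Context {R : realType} {d : measure_display} {T : measurableType d}
  (P : probability T R).

Lemma indep_g_sigma (G : set (set T)) (A : set T) : measurable A ->
  G `<=` measurable -> setI_closed G -> G [set: T] ->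
  (forall B, G B -> P (B `&` A) = P B * P A) ->
  forall B, <<s G >> B -> P (B `&` A) = P B * P A.
Proof.
move=> mA mG GI GT GA B GB.
pose r : {nonneg R} := NngNum (fine_ge0 (measure_ge0 P A)).
have rE : r%:num%:E = P A by rewrite -[RHS]fineK// fin_num_measure.
transitivity (mscale r P B); last by rewrite -rE muleC.
transitivity (mrestr P mA B); first by [].
apply: (g_sigma_algebra_measure_unique G mG (fun=> setT)) => //.
- by rewrite bigcup_const.
- by move=> C GC; transitivity (P C * P A); [exact: GA|rewrite -rE muleC].
- by move=> _; rewrite /= /mrestr setTI ltey_eq fin_num_measure.
Qed.

(** A pi-system generating the joint sigma-algebra of the block J, made of the intersections of
    which [mutually_independent] speaks. *)
Definition cylinders (I : finType) (F : I -> set (set T)) (J : {set I}) :=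
  [set E | exists2 e : I -> set T, forall i, i \in J -> F i (e i) &
    E = \bigcap_(i in [set` J]) e i].

Variables (I : finType) (F : I -> set (set T)).
Hypothesis mF : forall i, F i `<=` measurable.
Hypothesis FI : forall i, setI_closed (F i).
Hypothesis FT : forall i, F i [set: T].

Lemma cylinders_measurable J : cylinders F J `<=` measurable.
Proof.
move=> _ [e eF ->]; apply: fin_bigcap_measurable => [|i /= iJ].
  exact: finite_finset.
by apply: mF; exact: eF.
Qed.

Lemma cylinders_setI J : setI_closed (cylinders F J).
Proof.
move=> _ _ [e eF ->] [e' eF' ->]; exists (fun i => e i `&` e' i).
  by move=> i iJ; apply: FI; [exact: eF|exact: eF'].
by rewrite bigcapI.
Qed.

Lemma cylinders_setT J : cylinders F J [set: T].
Proof.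
exists (fun=> setT) => //.
by apply/seteqP; split => t.
Qed.

Lemma cylinders_sub (J : {set I}) i : i \in J -> F i `<=` cylinders F J.
Proof.
move=> iJ E FE; exists (fun j => if j == i then E else setT).
  by move=> j _; case: eqP => [->|_].
apply/seteqP; split => [t Et j _|t /(_ i iJ)]; last by rewrite eqxx.
by case: eqP.
Qed.

(** Extending from the pi-system in each factor in turn reduces the claim to two cylinders. As the
    blocks are disjoint, the two choices of events glue to one family h on the union, and the
    product over the union splits. *)
Lemma mutually_independent_blocks (J1 J2 : {set I}) (A B : set T) :
  mutually_independent P F -> (forall i, i \in J1 -> i \notin J2) ->
  <<s cylinders F J1 >> A -> <<s cylinders F J2 >> B ->
  P (A `&` B) = P A * P B.
Proof.
move=> indep J12 GA GB.
have mgen J C : <<s cylinders F J >> C -> measurable C.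
  apply: smallest_sub => //; first exact: sigma_algebra_measurable.
  exact: cylinders_measurable.
apply: (indep_g_sigma _ _ _ _ _ GA) => //; first exact: mgen GB.
- exact: cylinders_measurable.
- exact: cylinders_setI.
- exact: cylinders_setT.
move=> C CJ1; rewrite setIC muleC.
apply: (indep_g_sigma _ _ _ _ _ GB) => //; first exact: cylinders_measurable CJ1.
- exact: cylinders_measurable.
- exact: cylinders_setI.
- exact: cylinders_setT.
move=> D [e eF ->]; case: CJ1 => e' eF' -> {C}.
pose h i := if i \in J2 then e i else e' i.
have hJ2 i : i \in J2 -> h i = e i by rewrite /h => ->.
have hJ1 i : i \in J1 -> h i = e' i.
  by move=> iJ1; rewrite /h (negbTE (J12 i iJ1)).
have -> : \bigcap_(i in [set` J2]) e i = \bigcap_(i in [set` J2]) h i.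
  by apply: eq_bigcapr => i iJ2; rewrite hJ2.
have -> : \bigcap_(i in [set` J1]) e' i = \bigcap_(i in [set` J1]) h i.
  by apply: eq_bigcapr => i iJ1; rewrite hJ1.
have hF1 i : i \in J1 -> F i (h i) by move=> iJ; rewrite hJ1//; exact: eF'.
have hF2 i : i \in J2 -> F i (h i) by move=> iJ; rewrite hJ2//; exact: eF.
rewrite -bigcap_setU.
rewrite (_ : _ `|` _ = [set` J2 :|: J1]); last first.
  by apply/seteqP; split => i /=; rewrite finset.in_setU => /orP.
rewrite !indep//; last first.
  by move=> i; rewrite finset.in_setU => /orP[]; [exact: hF2|exact: hF1].
rewrite (finset.big_setID J2)/= finset.setUK; congr (_ * _).
apply: eq_bigl => i; rewrite finset.in_setD finset.in_setU andb_orr andNb/=.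
by apply: andb_idl => /J12.
Qed.

End independence.
Section density_measure.
Local Open Scope ereal_scope.
Context {R : realType} {d : measure_display} {T : measurableType d}
  (mu : {measure set T -> \bar R}).

Lemma ge0_integral_mrestr (F D : set T) (mF : measurable F) (f : T -> \bar R) :
  measurable D -> measurable_fun [set: T] f -> (forall t, 0 <= f t) ->
  \int[mrestr mu mF]_(t in D) f t = \int[mu]_(t in D `&` F) f t.
Proof.
move=> mD mf f0.
have mDF : measurable (D `&` F) by exact: measurableI.
have mDCF : measurable (D `\` F) by exact: measurableD.
rewrite -[in LHS](setUIDK D F) ge0_integral_setU//; last 2 first.
- exact: measurable_funTS.
- rewrite disj_set2E; apply/eqP; rewrite -subset0 => t [[_ Ft] [_ /(_ Ft)]] //.
rewrite [X in _ + X]null_set_integral ?adde0//; last 2 first.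
- exact: measurable_funTS.
- by rewrite /= /mrestr setDE -setIA setICl setI0 measure0.
apply: eq_measure_integral => A mA; rewrite subsetI => -[_ AF].
by rewrite /= /mrestr setIidl.
Qed.

Variables (f : T -> \bar R) (mf : measurable_fun [set: T] f)
  (f0 : forall t, 0 <= f t).

(** As for [kprecomp], the proofs are arguments so that the measure structure can be attached. *)
Definition mdensity of measurable_fun [set: T] f & (forall t, 0 <= f t) :
  set T -> \bar R := fun A => \int[mu]_(t in A) f t.

Let mdensity0 : mdensity mf f0 set0 = 0.
Proof. exact: integral_set0. Qed.

Let mdensity_ge0 A : 0 <= mdensity mf f0 A.
Proof. exact: integral_ge0. Qed.

Let mdensity_sigma_additive : semi_sigma_additive (mdensity mf f0).
Proof.
move=> F mF tF mUF; rewrite /mdensity ge0_integral_bigcup//; last first.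
  exact: measurable_funTS.
by apply: is_cvg_nneseries => n _ _; exact: integral_ge0.
Qed.

HB.instance Definition _ := isMeasure.Build _ _ _
  (mdensity mf f0) mdensity0 mdensity_ge0 mdensity_sigma_additive.

End density_measure.

(** * Markov property *)

Section markov.
Local Open Scope ereal_scope.
Context {R : realType} {d : measure_display} {T : measurableType d}
  (P : probability T R).
Context {d1 d2 d3} {U : measurableType d1} {V : measurableType d2}
  {W : measurableType d3}.

(** By independence, the law of Z under P restricted to F is its law under P, scaled by [P F]. *)
Lemma indep_integral (Z : {RV P >-> V}) (F : set T) (f : V -> \bar R)
    (C : set V) :
  measurable F ->
  (forall B, measurable B -> P (Z @^-1` B `&` F) = P (Z @^-1` B) * P F) ->
  measurable C -> measurable_fun [set: V] f -> (forall z, 0 <= f z) ->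
  \int[P]_(t in Z @^-1` C `&` F) f (Z t) =
  (\int[P]_(t in Z @^-1` C) f (Z t)) * P F.
Proof.
move=> mF indep mC mf f0.
pose r : {nonneg R} := NngNum (fine_ge0 (measure_ge0 P F)).
have rE : r%:num%:E = P F by rewrite -[RHS]fineK// fin_num_measure.
have mZC : measurable (Z @^-1` C).
  by rewrite -[X in measurable X]setTI; exact: measurable_funPT.
rewrite -ge0_integral_mrestr//; last exact: measurableT_comp.
transitivity (\int[mscale r (distribution P Z)]_(z in C) f z).
  rewrite -(ge0_integral_pushforward (measurable_funPT Z) _ (f := f))//; last first.
    exact: measurable_funTS.
  apply: eq_measure_integral => B mB _.
  by transitivity (P (Z @^-1` B) * P F); [exact: indep|rewrite -rE muleC].
rewrite ge0_integral_mscale//; last exact: measurable_funTS.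
rewrite [X in X * _ = _]rE muleC; congr (_ * _).
by rewrite ge0_integral_pushforward//; exact: measurable_funTS.
Qed.

(* Both sides are finite measures of the event [Y @^-1` B]; independence makes
   them agree on the pi-system of the events [Z @^-1` C `&` F]. *)
Lemma cond_law_markov (X : {RV P >-> U}) (Z : {RV P >-> V}) (Y : {RV P >-> W})
    (kappa : R.-pker V ~> U) (S : set (set T)) (A : set U) (B : set W) :
  is_cond_law X Z kappa ->
  S `<=` measurable -> setI_closed S -> S [set: T] ->
  (forall A C F, measurable A -> measurable C -> S F ->
    P (X @^-1` A `&` Z @^-1` C `&` F) = P (X @^-1` A `&` Z @^-1` C) * P F) ->
  (forall B, measurable B ->
    <<s [set Z @^-1` C `&` F | C in measurable & F in S] >> (Y @^-1` B)) ->
  measurable A -> measurable B ->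
  P (X @^-1` A `&` Y @^-1` B) = \int[P]_(t in Y @^-1` B) kappa (Z t) A.
Proof.
move=> XZ mS SI ST indep YG mA mB.
have mXA : measurable (X @^-1` A).
  by rewrite -[X in measurable X]setTI; exact: measurable_funPT.
have mZ C : measurable C -> measurable (Z @^-1` C).
  by move=> mC; rewrite -[X in measurable X]setTI; exact: measurable_funPT.
have mk : measurable_fun [set: T] (fun t => kappa (Z t) A).
  exact: measurableT_comp (measurable_kernel kappa A mA) (measurable_funPT Z).
have k0 t : 0 <= kappa (Z t) A by [].
transitivity (mdensity P mk k0 (Y @^-1` B)); last by [].
transitivity (mrestr P mXA (Y @^-1` B)); first by rewrite /mrestr setIC.
apply: (g_sigma_algebra_measure_unique
  [set Z @^-1` C `&` F | C in measurable & F in S] _ (fun=> setT)) => //.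
- by move=> _ [C mC [F SF <-]]; apply: measurableI; [exact: mZ|exact: mS].
- by move=> _; exists setT => //; exists setT => //; rewrite preimage_setT setTI.
- by rewrite bigcup_const.
- move=> _ _ [C mC [F SF <-]] [C' mC' [F' SF' <-]].
  exists (C `&` C'); first exact: measurableI.
  by exists (F `&` F'); [exact: SI|rewrite preimage_setI setIACA].
- move=> _ [C mC [F SF <-]]; rewrite /= /mrestr/= setIC setIA indep// XZ//.
  rewrite /mdensity (indep_integral (mS _ SF) _ mC (measurable_kernel kappa A mA))//.
    congr (_ * _); rewrite ge0_integral_pushforward//.
    exact/measurable_funTS/measurable_kernel.
  (* Independence of F from Z alone is the case in which the event for X is the whole space. *)
  move=> C' mC'; have := indep setT C' F measurableT mC' SF.
  by rewrite preimage_setT setTI.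
- by move=> _; rewrite /= /mrestr setTI ltey_eq fin_num_measure.
- exact: YG.
Qed.

End markov.

(** * The state-space model *)

Section state_space.
Context {R : realType} {disp : measure_display} {T : measurableType disp}
  (P : probability T R).

Lemma sigma_of_measurable {d1} {U : measurableType d1} (u : {RV P >-> U}) :
  sigma_of u `<=` measurable.
Proof. by move=> _ [B mB <-]; exact: measurable_funPT. Qed.

Lemma sigma_of_setI {d1} {U : measurableType d1} (u : {RV P >-> U}) :
  setI_closed (sigma_of u).
Proof.
move=> _ _ [B mB <-] [C mC <-]; exists (B `&` C); first exact: measurableI.
by rewrite preimage_setI setIIr.
Qed.

Lemma sigma_of_setT {d1} {U : measurableType d1} (u : {RV P >-> U}) :
  sigma_of u [set: T].
Proof. by exists setT => //; rewrite preimage_setT setTI. Qed.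

Lemma measurable_g_sigma_of {d1} {U : measurableType d1} (u : {RV P >-> U})
    (G : set (set T)) :
  sigma_of u `<=` G -> measurable_fun [set: g_sigma_algebraType G] u.
Proof. by move=> uG _ B mB; apply: sub_sigma_algebra; apply: uG; exists B. Qed.

Variables (d D K : nat) (A : nat -> 'M[R]_D) (H : nat -> 'M[R]_(d, D))
  (m0 : 'cV[R]_D) (C0 : 'M[R]_D) (B : nat -> 'M[R]_D) (S : nat -> 'M[R]_d)
  (theta : {RV P >-> 'cV[R]_D})
  (b : nat -> {RV P >-> 'cV[R]_D}) (r : nat -> {RV P >-> 'cV[R]_d})
  (x : nat -> {RV P >-> 'cV[R]_D}) (y : nat -> {RV P >-> 'cV[R]_d}).
Hypothesis hssm : linear_gaussian_ssm K A H m0 C0 B S theta b r x y.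

Local Notation noise := (noise_sigma (K := K) theta b r).

(* The noises theta, b_1, ..., b_n, r_1, ..., r_(n-1); the ordinal j stands for
   the time index j + 1. *)
Definition is_past (n : nat) (i : unit + ('I_K + 'I_K)) : bool :=
  match i with
  | inl _ => true
  | inr (inl j) => (j < n)%N
  | inr (inr j) => (j < n.-1)%N
  end.

Definition past_noise (n : nat) : {set (unit + ('I_K + 'I_K))%type} :=
  [set i | is_past n i]%SET.

Let measurable_noise i : noise i `<=` measurable.
Proof. by case: i => [[]|[j|j]]; exact: sigma_of_measurable. Qed.

Let noise_setI i : setI_closed (noise i).
Proof. by case: i => [[]|[j|j]]; exact: sigma_of_setI. Qed.

Let noise_setT i : noise i [set: T].
Proof. by case: i => [[]|[j|j]]; exact: sigma_of_setT. Qed.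

Section past.
Variable n : nat.
Hypothesis nK : (n < K)%N.
Local Notation past := (g_sigma_algebraType (cylinders noise (past_noise n))).

(** [past] is T with the sigma-algebra of the past noises; measurability there expresses that x_j is
    built from these noises only. *)
Lemma measurable_past_x j : (j <= n)%N -> measurable_fun [set: past] (x j).
Proof.
elim: j => [_|j IHj jn].
  rewrite (_ : (x 0%N : T -> _) = theta); last exact/funext/(ssm_x0 hssm).
  apply: measurable_g_sigma_of.
  by apply: (cylinders_sub noise_setT (i := inl tt)); rewrite inE.
have jK : (j < K)%N by exact: ltn_trans nK.
rewrite (_ : (x j.+1 : T -> _) = fun w => A j.+1 *m x j w + b j.+1 w); last first.
  by apply/funext => w; rewrite (ssm_x hssm).
apply: measurable_fun_addmx.
  by apply: measurable_fun_mulmx; exact: IHj (ltnW jn).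
apply: measurable_g_sigma_of.
by apply: (cylinders_sub noise_setT (i := inr (inl (Ordinal jK)))); rewrite inE.
Qed.

(** The observation y_n would bring in r_n, which is not a past noise; hence the bound j + 1 <= n -
    1. *)
Lemma measurable_past_y j : (j < n.-1)%N -> measurable_fun [set: past] (y j.+1).
Proof.
move=> jn; have jn' : (j.+1 <= n)%N by exact: leq_trans jn (leq_pred n).
have jK : (j < K)%N by exact: ltn_trans nK.
rewrite (_ : (y j.+1 : T -> _) = fun w => H j.+1 *m x j.+1 w + r j.+1 w); last first.
  by apply/funext => w; rewrite (ssm_y hssm).
apply: measurable_fun_addmx.
  by apply: measurable_fun_mulmx; exact: measurable_past_x.
apply: measurable_g_sigma_of.
by apply: (cylinders_sub noise_setT (i := inr (inr (Ordinal jK)))); rewrite inE.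
Qed.

Lemma measurable_past_obs : measurable_fun [set: past] (obs_upto y n.-1).
Proof.
apply/measurable_fun_tnthP => i.
rewrite (_ : _ \o _ = y i.+1); first exact: measurable_past_y.
by apply/funext => w /=; rewrite tnth_mktuple.
Qed.

End past.

(** Here n stands for k - 1. The noises split into the past block, from which x_0, x_n and y_(1:n-1)
    are built, and its complement, which supplies b_(n+1) and r_n. *)
Lemma ssm_markov (n : nat)
    (kappa : R.-pker ('cV[R]_D * n.-1.-tuple 'cV[R]_d) ~> 'cV[R]_D)
    (E : set 'cV[R]_D) (E' : set ('cV[R]_D * n.-tuple 'cV[R]_d)) :
  (n < K)%N ->
  is_cond_law (x 0%N) (rv_pair (x n) (obs_upto y n.-1)) kappa ->
  measurable E -> measurable E' ->
  (P (x 0%N @^-1` E `&` rv_pair (x n.+1) (obs_upto y n) @^-1` E') =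
   \int[P]_(t in rv_pair (x n.+1) (obs_upto y n) @^-1` E')
      kappa (x n t, obs_upto y n.-1 t) E)%E.
Proof.
move=> nK xz mE mE'.
pose past := cylinders noise (past_noise n).
pose future := cylinders noise (~: past_noise n)%SET.
have mfuture : <<s future >> `<=` measurable.
  apply: smallest_sub; first exact: sigma_algebra_measurable.
  exact: cylinders_measurable.
apply: (cond_law_markov (Z := rv_pair (x n) (obs_upto y n.-1)) (S := <<s future >>)
  xz) => //.
- by move=> F F'; exact: (@measurableI _ (g_sigma_algebraType future)).
- exact: (@measurableT _ (g_sigma_algebraType future)).
- move=> A' C F mA' mC FF.
  apply: (mutually_independent_blocks measurable_noise noise_setI noise_setT
    (J1 := past_noise n) (J2 := (~: past_noise n)%SET) (ssm_indep hssm)) => //.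
    by move=> i; rewrite finset.in_setC => ->.
  apply: (@measurableI _ (g_sigma_algebraType past)).
    rewrite -[X in measurable X]setTI.
    exact: (measurable_past_x nK (leq0n n)).
  rewrite -[X in measurable X]setTI.
  have mZ : measurable_fun [set: g_sigma_algebraType past]
      (rv_pair (x n) (obs_upto y n.-1)).
    apply: measurable_fun_pair; first exact: measurable_past_x.
    exact: measurable_past_obs.
  exact: mZ.
(* The sigma-algebra generated here is that of x_n, y_(1:n-1) and the remaining noises; what is left
   is to show that x_(n+1) and y_(1:n) are measurable for it. *)
set Gen := [set _ | _ in _ & _ in _].
have mZ : measurable_fun [set: g_sigma_algebraType Gen]
    (rv_pair (x n) (obs_upto y n.-1)).
  move=> _ C mC; rewrite setTI; apply: sub_sigma_algebra.
  exists C => //; exists setT; last by rewrite setIT.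
  exact: (@measurableT _ (g_sigma_algebraType future)).
have mx : measurable_fun [set: g_sigma_algebraType Gen] (x n).
  exact: (measurableT_comp measurable_fst mZ).
have my : measurable_fun [set: g_sigma_algebraType Gen] (obs_upto y n.-1).
  exact: (measurableT_comp measurable_snd mZ).
have mfut d1 (U : measurableType d1) (u : {RV P >-> U}) i :
    sigma_of u `<=` noise i -> i \notin past_noise n ->
    measurable_fun [set: g_sigma_algebraType Gen] u.
  move=> ui iJ; apply: measurable_g_sigma_of => _ [C mC <-].
  exists setT => //; exists (u @^-1` C); last by rewrite preimage_setT.
  apply: sub_sigma_algebra; apply: (cylinders_sub noise_setT (i := i)).
    by rewrite finset.in_setC.
  by apply: ui; exists C => //; rewrite setTI.
have mb : measurable_fun [set: g_sigma_algebraType Gen] (b n.+1).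
  by apply: (mfut _ _ _ (inr (inl (Ordinal nK)))); rewrite // inE/= ltnn.
have mxn : measurable_fun [set: g_sigma_algebraType Gen] (x n.+1).
  rewrite (_ : (x n.+1 : T -> _) = fun w => A n.+1 *m x n w + b n.+1 w).
    by apply: measurable_fun_addmx => //; exact: measurable_fun_mulmx.
  by apply/funext => w; rewrite (ssm_x hssm).
suff mY : measurable_fun [set: g_sigma_algebraType Gen]
    (rv_pair (x n.+1) (obs_upto y n)).
  by move=> F mF; rewrite -[X in <<s _ >> X]setTI; exact: mY.
apply: measurable_fun_pair => //; apply/measurable_fun_tnthP => i.
rewrite (_ : _ \o _ = y i.+1); last first.
  by apply/funext => w /=; rewrite tnth_mktuple.
(* The observations up to index n - 1 are components of the old ones; only y_n = H_n x_n + r_n uses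
   a new noise. *)
have [in1|] := ltnP i n.-1.
  rewrite (_ : (y i.+1 : T -> _) = fun w => tnth (obs_upto y n.-1 w) (Ordinal in1)).
    exact: (measurableT_comp (measurable_tnth _) my).
  by apply/funext => w; rewrite tnth_mktuple.
have n0 : (0 < n)%N by exact: leq_ltn_trans (ltn_ord i).
rewrite -ltnS prednK// => ni.
have {ni}iE : i.+1 = n by apply/eqP; rewrite eqn_leq ni ltn_ord.
have iK : (i < K)%N by exact: ltn_trans (ltn_ord i) nK.
rewrite (_ : (y i.+1 : T -> _) = fun w => H i.+1 *m x n w + r i.+1 w); last first.
  by apply/funext => w; rewrite (ssm_y hssm)// iE.
apply: measurable_fun_addmx; first exact: measurable_fun_mulmx.
apply: (mfut _ _ _ (inr (inr (Ordinal iK)))) => //.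
by rewrite inE/= -leqNgt -ltnS iE prednK.
Qed.

End state_space.

Lemma measurable_obs_prev {d} {U : measurableType d} {n} :
  measurable_fun [set: n.-tuple U] (@obs_prev U n).
Proof.
apply/measurable_fun_tnthP => i.
rewrite (_ : _ \o _ = @tnth n U ^~ (widen_ord (leq_pred n) i)).
  exact: measurable_tnth.
by apply/funext => s /=; rewrite tnth_mktuple.
Qed.

Lemma obs_prev_upto {d d1} {T : measurableType d} {U : measurableType d1}
    (y : nat -> {mfun T >-> U}) n t :
  obs_prev (obs_upto y n t) = obs_upto y n.-1 t.
Proof. by apply: eq_from_tnth => i; rewrite !tnth_mktuple. Qed.

Lemma quad_form_mul_tr_ge0 {R : realType} n (L : 'M[R]_n) (a : 'cV[R]_n) :
  0 <= (a^T *m (L *m L^T) *m a) 0 0.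
Proof.
rewrite mulmxA -mulmxA -[a in X in 0 <= X]trmxK -trmx_mul trmxK mxE.
by apply: sumr_ge0 => i _; rewrite [X in _ * X]mxE -expr2 sqr_ge0.
Qed.

(** * Gaussian mixtures and the recursion step *)

Section gaussian_mixture.
Context {R : realType}.

(** Tested against a, the law [k w] depends on w only through the scalar (G^T a)^T w. The integral
    therefore moves to the pushforward of [mu] under this form, a univariate normal law, where
    [integral_normal1] applies. *)
Lemma is_gaussian_mixture m n (mu : {measure set 'cV[R]_n -> \bar R})
    (k : 'cV[R]_n -> set 'cV[R]_m -> \bar R) (nu : set 'cV[R]_m -> \bar R)
    (G : 'M[R]_(m, n)) (q : 'cV[R]_n) (p : 'cV[R]_m) (L : 'M[R]_n) (M : 'M[R]_m) :
  is_gaussian mu q (L *m L^T) ->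
  (forall B, measurable B -> measurable_fun [set: 'cV[R]_n] (k ^~ B)) ->
  {ae mu, forall w, is_gaussian (k w) (G *m w + p) (M *m M^T)} ->
  (forall B, measurable B -> nu B = \int[mu]_w k w B)%E ->
  is_gaussian nu (G *m q + p) (G *m L *m L^T *m G^T + M *m M^T).
Proof.
move=> mu_gauss mk k_gauss nuE a B mB; set l := fun u => _.
have ml : measurable_fun [set: 'cV[R]_m] l by exact: measurable_linear_form.
have mlB : measurable (l @^-1` B) by rewrite -[X in measurable X]setTI; exact: ml.
rewrite /pushforward nuE//.
pose v2 := (a^T *m (M *m M^T) *m a) 0 0.
pose c := (a^T *m p) 0 0.
pose l' (w : 'cV[R]_n) : measurableTypeR R := ((G^T *m a)^T *m w) 0 0.
have ml' : measurable_fun [set: 'cV[R]_n] l' by exact: measurable_linear_form.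
have v20 : 0 <= v2 by exact: quad_form_mul_tr_ge0.
transitivity (\int[mu]_w normal1 (l' w + c)%R v2 B)%E.
  apply: ae_eq_integral => //; first exact: mk.
    by apply: (measurableT_comp (measurable_normal1_center c mB v20)).
  apply: filterS k_gauss => w + _ => /(_ a B mB); rewrite /pushforward => ->.
  rewrite (_ : (a^T *m (G *m w + p)) 0 0 = l' w + c)//.
  by rewrite /l' /c trmx_mul trmxK -mulmxA mulmxDr mxE mulmxA.
pose v1 := ((G^T *m a)^T *m (L *m L^T) *m (G^T *m a)) 0 0.
pose m' := ((G^T *m a)^T *m q) 0 0.
transitivity (\int[pushforward mu l']_t normal1 (t + c)%R v2 B)%E.
  rewrite (ge0_integral_pushforward ml')//.
    exact: measurable_normal1_center.
  by move=> t _; exact: normal1_ge0.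
transitivity (normal1 (m' + c) (v1 + v2) B).
  apply: integral_normal1 => //; first exact: quad_form_mul_tr_ge0.
  by move=> C mC; exact: mu_gauss.
congr (normal1 _ _ B); rewrite /m' /c /v1 /v2.
  by rewrite trmx_mul trmxK mulmxDr [RHS]mxE !mulmxA.
by rewrite trmx_mul trmxK mulmxDr mulmxDl [RHS]mxE !mulmxA.
Qed.

End gaussian_mixture.

Section cond_gaussian_step.
Context {R : realType} {disp : measure_display} {T : measurableType disp}
  (P : probability T R).
Variables (d D K : nat) (A : nat -> 'M[R]_D) (H : nat -> 'M[R]_(d, D))
  (m0 : 'cV[R]_D) (C0 : 'M[R]_D) (B : nat -> 'M[R]_D) (S : nat -> 'M[R]_d)
  (theta : {RV P >-> 'cV[R]_D})
  (b : nat -> {RV P >-> 'cV[R]_D}) (r : nat -> {RV P >-> 'cV[R]_d})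
  (x : nat -> {RV P >-> 'cV[R]_D}) (y : nat -> {RV P >-> 'cV[R]_d}).
Hypothesis hssm : linear_gaussian_ssm K A H m0 C0 B S theta b r x y.

(** A Gaussian law depends on its factor only through M M^T, so M may be any factor of the
    propagated covariance. *)
Lemma ssm_cond_gaussian_step n (G Gamma L Lambda M : 'M[R]_D)
    (p : n.-1.-tuple 'cV[R]_d -> 'cV[R]_D) (q : n.-tuple 'cV[R]_d -> 'cV[R]_D) :
  (n < K)%N ->
  cond_gaussian (x 0%N) (x n) (obs_upto y n.-1) G p L ->
  cond_gaussian (x n) (x n.+1) (obs_upto y n) Gamma q Lambda ->
  M *m M^T = G *m Lambda *m Lambda^T *m G^T + L *m L^T ->
  cond_gaussian (x 0%N) (x n.+1) (obs_upto y n)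
    (G *m Gamma) (fun ys => G *m q ys + p (obs_prev ys)) M.
Proof.
move=> nK [k1 [law1 gauss1]] [k2 [law2 gauss2]] ME.
pose g (z : ('cV[R]_D * n.-tuple 'cV[R]_d) * 'cV[R]_D) := (z.2, obs_prev z.1.2).
have mg : measurable_fun [set: _] g.
  apply: measurable_fun_pair => //.
  exact: (measurableT_comp measurable_obs_prev
    (measurableT_comp measurable_snd measurable_fst)).
pose kappa := kmix k2 (kprecomp k1 mg).
have mg' : measurable_fun [set: _]
    (fun z : 'cV[R]_D * ('cV[R]_D * n.-tuple 'cV[R]_d) => (z.1, obs_prev z.2.2)).
  apply: measurable_fun_pair => //.
  exact: (measurableT_comp measurable_obs_prev
    (measurableT_comp measurable_snd measurable_snd)).
exists kappa; split.
  move=> E E' mE mE'; rewrite (ssm_markov hssm nK law1)//.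
  (* The Markov identity still evaluates [k1] at the random x_n; integrating x_n out against [k2]
     turns the integrand into [kappa]. *)
  pose f (z : 'cV[R]_D * ('cV[R]_D * n.-tuple 'cV[R]_d)) :=
    (k1 (z.1, obs_prev z.2.2) E * (\1_E' z.2)%:E)%E.
  transitivity (\int[P]_t f (x n t, rv_pair (x n.+1) (obs_upto y n) t))%E.
    rewrite integral_mkcond/=; apply: eq_integral => t _.
    rewrite patchE /f/= obs_prev_upto indicE.
    rewrite (_ : (_ \in _ @^-1` _) = (rv_pair (x n.+1) (obs_upto y n) t \in E')).
      by case: ifP => _; rewrite ?mule1 ?mule0.
    by apply/idP/idP => /set_mem h; exact/mem_set.
  have mI : measurable_fun [set: _] (\1_E' : _ -> R) by exact: measurable_indic.
  rewrite -(cond_law_integral law2); last 2 first.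
  - apply: emeasurable_funM.
      exact: (measurableT_comp (measurable_kernel k1 E mE) mg').
    apply/measurable_EFinP.
    exact: (measurableT_comp mI measurable_snd).
  - by move=> z; rewrite mule_ge0// lee_fin.
  rewrite [RHS]integral_mkcond/=; apply: eq_integral => z _.
  rewrite patchE /f/= indicE; case: ifP => _; last first.
    by apply: integral0_eq => w _; rewrite mule0.
  by apply: eq_integral => w _; rewrite mule1.
have [N [mN N0 gaussN]] := gauss1.
have mpair (z : 'cV[R]_D * n.-tuple 'cV[R]_d) :
    measurable_fun [set: 'cV[R]_D] (fun w => (w, obs_prev z.2)).
  exact: measurable_fun_pair.
have mNz (z : 'cV[R]_D * n.-tuple 'cV[R]_d) : measurable [set w | N (w, obs_prev z.2)].
  by rewrite -[X in measurable X]setTI; exact: (mpair z measurableT _ mN).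
(* Averaging the [k2]-measures of the sections of N over the law of (x_(n+1), y_(1:n)) gives the
   probability that (x_n, y_(1:n-1)) lies in N, which is 0. A nonnegative function with integral 0
   vanishes almost everywhere. *)
have {}N0 : {ae distribution P (rv_pair (x n.+1) (obs_upto y n)), forall z,
    k2 z [set w | N (w, obs_prev z.2)] = 0%E}.
  pose f (z : 'cV[R]_D * ('cV[R]_D * n.-tuple 'cV[R]_d)) : \bar R :=
    (\1_N (z.1, obs_prev z.2.2))%:E.
  have mf : measurable_fun [set: _] f.
    apply/measurable_EFinP.
    have mI : measurable_fun [set: _] (\1_N : _ -> R) by exact: measurable_indic.
    exact: (measurableT_comp mI mg').
  have f0 z : (0 <= f z)%E by rewrite lee_fin.
  have fE z : (\int[k2 z]_w f (w, z) = k2 z [set w | N (w, obs_prev z.2)])%E.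
    by rewrite -[in RHS](setIT [set w | _]) -integral_indic.
  have mint : measurable_fun [set: _] (fun z => \int[k2 z]_w f (w, z))%E.
    apply: (measurable_fun_integral_finite_kernel (fun z => f (z.2, z.1)) k2) => //.
    have mswap : measurable_fun
        [set: ('cV[R]_D * n.-tuple 'cV[R]_d) * 'cV[R]_D] (fun z => (z.2, z.1)).
      exact: measurable_fun_pair.
    exact: (measurableT_comp mf mswap).
  have [+ _] := ae_eq_integral_abs
    (distribution P (rv_pair (x n.+1) (obs_upto y n))) measurableT mint.
  suff -> : (\int[distribution P (rv_pair (x n.+1) (obs_upto y n))]_z
      `|\int[k2 z]_w f (w, z)| = 0)%E.
    move=> /(_ erefl); apply: filterS => z /(_ Logic.I).
    by rewrite fE.
  under eq_integral do rewrite gee0_abs ?integral_ge0//.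
  rewrite (cond_law_integral law2)// /f.
  rewrite -[RHS]N0 -[in RHS](setIT N) -integral_indic//.
  rewrite ge0_integral_distribution//; last first.
    by apply/measurable_EFinP; exact: measurable_indic.
  by apply: eq_integral => t _; rewrite /= obs_prev_upto.
apply: filterS2 gauss2 N0 => z gauss2z Nz.
rewrite ME -mulmxA addrA -mulmxDr.
apply: (is_gaussian_mixture gauss2z (k := fun w => k1 (w, obs_prev z.2))) => //.
  by move=> E mE; exact: (measurableT_comp (measurable_kernel k1 E mE)).
exists [set w | N (w, obs_prev z.2)]; split; [exact: mNz|exact: Nz|].
by move=> w nongauss; apply: gaussN => gauss; exact: nongauss.
Qed.

End cond_gaussian_step.

(** * Gram matrices and QR decompositions *)

Section gram.
Context {R : realFieldType}.
Implicit Types m n : nat.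

Lemma mulmx_tr_eq0 m (u : 'cV[R]_m) : ((u^T *m u) 0 0 == 0) = (u == 0).
Proof.
apply/idP/eqP => [|->]; last by rewrite mulmx0 mxE.
rewrite mxE psumr_eq0 => [/allP u0|i _]; last by rewrite mxE -expr2 sqr_ge0.
apply/colP => i; have := u0 i; rewrite mem_index_enum => /(_ isT).
by rewrite !mxE -expr2 sqrf_eq0 => /eqP.
Qed.

(** Householder reflection; dividing by u^T u instead of normalising u avoids square roots. *)
Definition reflection m (u : 'cV[R]_m) : 'M[R]_m :=
  1%:M - (2 / (u^T *m u) 0 0) *: (u *m u^T).

Lemma reflectionE m (u v : 'cV[R]_m) :
  reflection u *m v = v - (2 * (u^T *m v) 0 0 / (u^T *m u) 0 0) *: u.
Proof.
rewrite mulmxBl mul1mx -scalemxAl -mulmxA [in LHS](mx11_scalar (u^T *m v)) mul_mx_scalar.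
by rewrite scalerA mulrAC.
Qed.

Lemma reflection_orthogonal m (u : 'cV[R]_m) :
  u != 0 -> (reflection u)^T *m reflection u = 1%:M.
Proof.
rewrite -mulmx_tr_eq0 => u0; have -> : (reflection u)^T = reflection u.
  by rewrite /reflection linearB/= linearZ/= trmx1 trmx_mul trmxK.
rewrite {2}/reflection mulmxBr mulmx1 -scalemxAr mulmxA reflectionE.
rewrite mulfK// mulmxBl -scalemxAl /reflection.
rewrite [X in _ - _ *: X](_ : _ = - (u *m u^T)); last first.
  by rewrite scaler_nat mulr2n opprD addrA subrr sub0r.
by rewrite scalerN opprK subrK.
Qed.

(* Matrices with equal Gram matrices differ by an isometry: if U maps the first
   k columns correctly and a, b are the image and the target of the next one,
   the reflection along a - b fixes the former and maps a to b. *)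
Lemma gram_eq_orthogonal m n (M N : 'M[R]_(m, n)) :
  M^T *m M = N^T *m N -> exists2 U : 'M[R]_m, U^T *m U = 1%:M & U *m N = M.
Proof.
move=> MN.
have dotE i j : ((col i M)^T *m col j M) 0 0 = ((col i N)^T *m col j N) 0 0.
  by rewrite !colE !trmx_mul !mulmxA -[_ *m M^T *m M]mulmxA MN mulmxA.
suff /(_ n (leqnn n))[U UU UN] : forall k, (k <= n)%N ->
    exists2 U : 'M[R]_m, U^T *m U = 1%:M &
      forall j : 'I_n, (j < k)%N -> U *m col j N = col j M.
  exists U => //; apply/matrixP => i j.
  move: (UN j (ltn_ord j)); rewrite colE mulmxA -colE => /colP/(_ i).
  by rewrite [LHS]mxE [RHS]mxE.
elim=> [_|k IHk kn]; first by exists 1%:M; rewrite // trmx1 mul1mx.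
have [U UU UN] := IHk (ltnW kn); pose j := Ordinal kn.
have dotU (v w : 'cV[R]_m) : (U *m v)^T *m (U *m w) = v^T *m w.
  by rewrite trmx_mul mulmxA -(mulmxA _ U^T) UU mulmx1.
pose a := U *m col j N; pose c := col j M; pose u := a - c.
have [u0|u0] := eqVneq u 0.
  exists U => // i; rewrite ltnS leq_eqVlt => /orP[/eqP ij|]; last exact: UN.
  have -> : i = j by exact/val_inj.
  by apply/eqP; rewrite -subr_eq0 -/a -/c -/u u0.
have comm (v w : 'cV[R]_m) : (v^T *m w) 0 0 = (w^T *m v) 0 0.
  by rewrite -[v^T *m w]trmxK trmx_mul trmxK mxE.
have aa : (a^T *m a) 0 0 = (c^T *m c) 0 0 by rewrite dotU dotE.
have uE : u^T = a^T - c^T by rewrite /u linearB.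
have subE (X Y : 'M[R]_1) : (X - Y) 0 0 = X 0 0 - Y 0 0 by rewrite !mxE.
exists (reflection u *m U).
  by rewrite trmx_mul mulmxA -(mulmxA _ (reflection u)^T) reflection_orthogonal// mulmx1.
move=> i; rewrite ltnS leq_eqVlt -mulmxA => /orP[/eqP ij|ik].
  have -> : i = j by exact/val_inj.
  rewrite -/a -/c reflectionE.
  (* Since a and c have equal length, the reflection subtracts exactly u = a - c from a. *)
  have u2 : (u^T *m u) 0 0 = 2 * (u^T *m a) 0 0.
    by rewrite {2}/u mulmxBr uE !mulmxBl !subE (comm a c) aa; ring.
  rewrite -u2 divff ?mulmx_tr_eq0// scale1r.
  by rewrite /u opprB addrCA subrr addr0.
(* The earlier columns have the same inner product with a as with c, so they are orthogonal to u and
   stay fixed. *)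
rewrite UN// reflectionE [(u^T *m _) 0 0](_ : _ = 0) ?mulr0 ?mul0r ?scale0r ?subr0//.
by rewrite uE mulmxBl subE dotE -[in X in X - _](UN i ik) dotU subrr.
Qed.

End gram.

(** Padding Rf with zero rows gives it the shape of M without changing its Gram matrix. The first n
    columns of the isometry between the two form Q, whatever the rank of Rf. *)
Lemma reduced_qr_of_gram (R : realType) m n (Rf : 'M[R]_n) (M : 'M[R]_(n + m, n)) :
  Rf^T *m Rf = M^T *m M -> (forall i j : 'I_n, (j < i)%N -> Rf i j = 0) ->
  exists Q, reduced_qr Q Rf M.
Proof.
move=> RM Rtri.
have [|U UU UN] := @gram_eq_orthogonal R _ _ M (col_mx Rf (0 : 'M[R]_(m, n))).
  by rewrite tr_col_mx mul_row_col trmx0 mul0mx addr0.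
exists (lsubmx U); split => //; last first.
  by rewrite -UN -[U in RHS]hsubmxK mul_row_col mulmx0 addr0.
move: UU; rewrite -{1 2}[U]hsubmxK tr_row_mx mul_col_row scalar_mx_block.
by move=> /eq_block_mx[].
Qed.

Lemma reduced_qr_gram (R : realType) m n (Q : 'M[R]_(m, n)) (U : 'M[R]_n) M :
  reduced_qr Q U M -> U^T *m U = M^T *m M.
Proof.
by move=> [QQ _ <-]; rewrite trmx_mul mulmxA -(mulmxA _ Q^T) QQ mulmx1.
Qed.

(** Polarisation: the values at e_i + e_j recover the entries of a symmetric form from its quadratic
    form. *)
Lemma gram_of_norms (R : realFieldType) m m' n (M : 'M[R]_(m, n)) (N : 'M[R]_(m', n)) :
  (forall u : 'cV[R]_n,
    ((M *m u)^T *m (M *m u)) 0 0 = ((N *m u)^T *m (N *m u)) 0 0) ->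
  M^T *m M = N^T *m N.
Proof.
move=> MN; pose q (A : 'M[R]_n) (u v : 'cV[R]_n) := (u^T *m A *m v) 0 0.
have qD A u v w : q A (u + v) w = q A u w + q A v w.
  by rewrite /q linearD/= !mulmxDl mxE.
have qDr A u v w : q A w (u + v) = q A w u + q A w v.
  by rewrite /q mulmxDr mxE.
have qE (A : 'M[R]_n) i j : q A (delta_mx i 0) (delta_mx j 0) = A i j.
  by rewrite /q trmx_delta -rowE -colE !mxE.
have qsym (m0 : nat) (A : 'M[R]_(m0, n)) u v : q (A^T *m A) u v = q (A^T *m A) v u.
  by rewrite /q -[u^T *m _ *m v]trmxK [LHS]mxE !trmx_mul !trmxK !mulmxA.
have qMN u : q (M^T *m M) u u = q (N^T *m N) u u.
  by have := MN u; rewrite /q !trmx_mul !mulmxA.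
apply/matrixP => i j; rewrite -!qE.
have := qMN (delta_mx i 0 + delta_mx j 0); rewrite !qD !qDr !qMN.
rewrite (qsym _ M (delta_mx j 0)) (qsym _ N (delta_mx j 0)) => h; lra.
Qed.

(** * The algorithm *)

Section computations.
Local Open Scope nat_scope.

(* Programs with a return value; [compile] supplies to the continuation in [Op]
   the address of the computed number. *)
Inductive comp (A : Type) :=
  | Ret of A
  | Op of flop & (nat -> comp A)
  | If of nat & nat & comp A & comp A.

Fixpoint bind {A B} (m : comp A) (k : A -> comp B) : comp B :=
  match m with
  | Ret a => k a
  | Op f q => Op f (fun i => bind (q i) k)
  | If i j q1 q2 => If i j (bind q1 k) (bind q2 k)
  end.

Fixpoint compile (m : comp (seq nat)) (n : nat) : program :=
  match m with
  | Ret s => Output s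
  | Op f q => Compute f (compile (q n) n.+1)
  | If i j q1 q2 => Branch i j (compile q1 n) (compile q2 n)
  end.

Fixpoint mapM {A B} (f : A -> comp B) (s : seq A) : comp (seq B) :=
  if s is a :: s' then
    bind (f a) (fun b => bind (mapM f s') (fun bs => Ret (b :: bs)))
  else Ret [::].

Fixpoint dotp (s t : seq nat) : comp nat :=
  match s, t with
  | i :: s', j :: t' =>
    Op (Mul i j) (fun m => bind (dotp s' t') (fun l => Op (Add m l) (@Ret _)))
  | _, _ => Op (Const 0%R) (@Ret _)
  end.

Definition affp (v : seq nat) (rj : seq nat * nat) : comp nat :=
  bind (dotp rj.1 v) (fun i => Op (Add i rj.2) (@Ret _)).

Definition mulp (rows cols : seq (seq nat)) : comp (seq (seq nat)) :=
  mapM (fun s => mapM (dotp s) cols) rows.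

Definition rotp (c s : nat) (ab : nat * nat) : comp (nat * nat) :=
  Op (Mul c ab.1) (fun ca => Op (Mul s ab.2) (fun sb =>
  Op (Mul c ab.2) (fun cb => Op (Mul s ab.1) (fun sa =>
  Op (Add ca sb) (fun i => Op (Defs.Sub cb sa) (fun j => Ret (i, j))))))).

(* Givens rotations annihilating the row v against the rows of an upper
   triangular matrix, which are stored from the diagonal on; z is the address of
   a zero. *)
Fixpoint givensp (z : nat) (rows : seq (seq nat)) (v : seq nat) :
    comp (seq (seq nat)) :=
  match rows, v with
  | (a :: s) :: rows', b :: v' =>
    Op (Mul a a) (fun aa => Op (Mul b b) (fun bb => Op (Add aa bb) (fun nn =>
    (* A squared norm at most 0 means a = b = 0: nothing has to be annihilated, and the division by
       the norm would be an error. *)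
    If nn z
      (bind (givensp z rows' v') (fun rs => Ret ((a :: s) :: rs)))
      (Op (Sqrt nn) (fun n => Op (Div a n) (fun cos => Op (Div b n) (fun sin =>
       bind (mapM (rotp cos sin) (zip s v')) (fun ps =>
       bind (givensp z rows' (unzip2 ps)) (fun rs =>
       Ret ((n :: unzip1 ps) :: rs))))))))))
  | _, _ => Ret rows
  end.

Fixpoint qrp (z : nat) (rows vs : seq (seq nat)) : comp (seq (seq nat)) :=
  if vs is v :: vs' then bind (givensp z rows v) (fun rows' => qrp z rows' vs')
  else Ret rows.

(** The rows have lengths n, ..., 1: a zero upper triangular matrix stored from the diagonal on. *)
Fixpoint zero_rows {A} (z : A) (n : nat) : seq (seq A) :=
  if n is n'.+1 then nseq n z :: zero_rows z n' else [::].

Definition rows_at (D off : nat) : seq (seq nat) :=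
  [seq [seq off + (i * D + j) | j : 'I_D] | i : 'I_D].

Definition cols_at (D off : nat) : seq (seq nat) :=
  [seq [seq off + (i * D + j) | i : 'I_D] | j : 'I_D].

Definition vec_at (D off : nat) : seq nat := [seq off + i | i : 'I_D].

(** The transpose of the stored factor is read out; since row j is stored from the diagonal on, its
    entry in column i sits at position i - j. *)
Definition lower_cells (D z : nat) (rows : seq (seq nat)) : seq nat :=
  [seq if j <= i then nth z (nth [::] rows j) (i - j) else z
     | i : 'I_D <- enum 'I_D, j : 'I_D <- enum 'I_D].

(* The input consists of G, p, L, Gamma, pi, Lambda, in this order. *)
Definition update_comp (D : nat) : comp (seq nat) :=
  let DD := D * D in
  let oG := 0 in let op := DD in let oL := op + D in let oC := oL + DD in
  let oq := oC + DD in let oM := oq + D in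
  bind (mulp (rows_at D oG) (cols_at D oC)) (fun GC =>
  bind (mapM (affp (vec_at D oq)) (zip (rows_at D oG) (vec_at D op))) (fun v =>
  (* This is Lambda^T G^T: the columns of Lambda serve as rows and the rows of G as columns, so
     transposing costs no operation. *)
  bind (mulp (cols_at D oM) (rows_at D oG)) (fun W =>
  Op (Const 0%R) (fun z =>
  bind (qrp z (zero_rows z D) (W ++ cols_at D oL)) (fun rows =>
  Ret (flatten GC ++ v ++ lower_cells D z rows)))))).

(** 4 D^2 + 2 D is the length of the input, hence the address of the first computed number. *)
Definition update_algo (D : nat) : program :=
  compile (update_comp D) (4 * (D * D) + 2 * D).

End computations.

(** * Program logic with an operation count *)

Section weakest_preconditions.
Context {R : realType}.
Implicit Types (mem : seq R).

(* [c] bounds the number of executed operations. *)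
Fixpoint wp {A} (m : comp A) mem (c : nat) (Q : A -> seq R -> Prop) : Prop :=
  match m with
  | Ret a => Q a mem
  | Op f q =>
    if c is c'.+1 then
      if eval_flop f mem is Some v then wp (q (size mem)) (rcons mem v) c' Q
      else False
    else False
  | If i j q1 q2 =>
    if c is c'.+1 then wp (if mem`_i <= mem`_j then q1 else q2) mem c' Q
    else False
  end.

(** Execution only appends to the memory, so the postconditions are compared only on extensions of
    the initial memory. *)
Lemma wp_weaken {A} (m : comp A) mem c c' (Q Q' : A -> seq R -> Prop) :
  wp m mem c Q -> (c <= c')%N ->
  (forall a ext, Q a (mem ++ ext) -> Q' a (mem ++ ext)) -> wp m mem c' Q'.
Proof.
elim: m mem c c' => [a|f q IH|i j q1 IH1 q2 IH2] mem c c' /=.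
- by move=> Qa _ /(_ a [::]); rewrite cats0; exact.
- case: c c' => [//|c] [//|c']; case: eval_flop => // v wpq cc' QQ'.
  apply: IH wpq cc' _ => a ext Qa.
  by rewrite cat_rcons; apply: QQ'; rewrite -cat_rcons.
- case: c c' => [//|c] [//|c'] wpq cc' QQ'.
  by case: ifP wpq => _ wpq; [exact: IH1 wpq cc' QQ'|exact: IH2 wpq cc' QQ'].
Qed.

Lemma wp_bind {A B} (m : comp A) (k : A -> comp B) mem c1 c2 c Q Q' :
  wp m mem c1 Q -> (c1 + c2 <= c)%N ->
  (forall a ext, Q a (mem ++ ext) -> wp (k a) (mem ++ ext) c2 Q') ->
  wp (bind m k) mem c Q'.
Proof.
elim: m mem c1 c => [a|f q IH|i j q1 IH1 q2 IH2] mem c1 c /=.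
- move=> Qa c12 /(_ a [::]); rewrite cats0 => /(_ Qa) /wp_weaken; apply => //.
  exact: leq_trans (leq_addl _ _) c12.
- case: c1 c => [//|c1] [//|c]; case: eval_flop => // v wpq c12 QQ'.
  apply: (IH _ _ _ _ wpq c12) => a ext Qa.
  by rewrite cat_rcons; apply: QQ'; rewrite -cat_rcons.
- case: c1 c => [//|c1] [//|c] wpq c12 QQ'.
  by case: ifP wpq => _ wpq; [exact: IH1 wpq c12 QQ'|exact: IH2 wpq c12 QQ'].
Qed.

(** [compile] names each result by the current length of the memory, and every operation appends
    exactly one cell, which keeps the two in step. *)
Lemma wp_run (m : comp (seq nat)) mem c Q : wp m mem c Q ->
  exists s mem' cost,
    [/\ run (compile m (size mem)) mem = Some ([seq mem'`_i | i <- s], cost),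
        Q s mem' & (cost <= c)%N].
Proof.
elim: m mem c => [s|f q IH|i j q1 IH1 q2 IH2] mem c /=.
- by move=> Qs; exists s, mem, 0%N.
- case: c => [//|c]; case: eval_flop => // v /IH[s [mem' [cost [+ Qs cc]]]].
  by rewrite size_rcons => ->; exists s, mem', cost.+1.
- case: c => [//|c]; case: ifP => _ => [/IH1|/IH2] [s [mem' [cost [-> Qs cc]]]];
  by exists s, mem', cost.+1.
Qed.

End weakest_preconditions.

Section forall2.
Context {A B A' B' : Type}.

Lemma Forall2_sub (r r' : A -> B -> Prop) s t :
  (forall a b, r a b -> r' a b) -> List.Forall2 r s t -> List.Forall2 r' s t.
Proof. by move=> rr'; elim=> [|a b s' t' /rr' ab _ IH]; constructor. Qed.

Lemma Forall2_nill (r : A -> B -> Prop) t : List.Forall2 r [::] t -> t = [::].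
Proof. by move=> h; inversion h. Qed.

Lemma Forall2_consl (r : A -> B -> Prop) a s t : List.Forall2 r (a :: s) t ->
  exists b t', [/\ t = b :: t', r a b & List.Forall2 r s t'].
Proof. by move=> h; inversion h as [|a' b s' t' ab st]; exists b, t'. Qed.

Lemma Forall2_map (r : A' -> B' -> Prop) (f : A -> A') (g : B -> B') s t :
  List.Forall2 (fun a b => r (f a) (g b)) s t ->
  List.Forall2 r (map f s) (map g t).
Proof. by elim=> [|a b s' t' ab _ IH]; constructor. Qed.

Lemma Forall2_zip (r : A -> B -> Prop) (r' : A' -> B' -> Prop) s t s' t' :
  List.Forall2 r s t -> List.Forall2 r' s' t' ->
  List.Forall2 (fun a b => r a.1 b.1 /\ r' a.2 b.2) (zip s s') (zip t t').
Proof.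
move=> st; elim: st s' t' => [|a b u v ab _ IH] s' t' [|a' b' u' v' ab' uv'];
by constructor => //; exact: IH.
Qed.

Lemma Forall2_cat (r : A -> B -> Prop) s t s' t' :
  List.Forall2 r s t -> List.Forall2 r s' t' ->
  List.Forall2 r (s ++ s') (t ++ t').
Proof. by move=> st st'; elim: st => //= a b u v ab _ IH; constructor. Qed.

Lemma Forall2_nth (r : A -> B -> Prop) a b s t k : r a b ->
  List.Forall2 r s t -> r (nth a s k) (nth b t k).
Proof. by move=> ab st; elim: st k => [|? ? ? ? ? _ IH] [|k] //=; exact: IH. Qed.

End forall2.
Arguments Forall2_consl {A B r a s t}.

Lemma Forall2_map_same {I A B : Type} (r : A -> B -> Prop) (f : I -> A)
    (g : I -> B) (s : seq I) :
  (forall i, r (f i) (g i)) -> List.Forall2 r (map f s) (map g s).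
Proof. by move=> fg; elim: s => [|i s IH]; constructor. Qed.

(** * Correctness and cost of the subroutines *)

Section correctness.
Context {R : realType}.
Implicit Types (mem u v : seq R).

(** [onth] requires the address to exist, so the fact survives any extension of the memory; the
    default 0 of [nth] would not. *)
Definition cell mem (i : nat) (a : R) : Prop := onth mem i = Some a.
Definition cells mem : seq nat -> seq R -> Prop := List.Forall2 (cell mem).
Definition rows mem : seq (seq nat) -> seq (seq R) -> Prop :=
  List.Forall2 (cells mem).

Lemma cell_cat mem ext i a : cell mem i a -> cell (mem ++ ext) i a.
Proof.
by rewrite /cell onth_cat => mi; rewrite -onthTE mi.
Qed.

Lemma cells_cat mem ext s u : cells mem s u -> cells (mem ++ ext) s u.
Proof. by apply: Forall2_sub => i a; exact: cell_cat. Qed.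

Lemma rows_cat mem ext s (u : seq (seq R)) : rows mem s u -> rows (mem ++ ext) s u.
Proof. by apply: Forall2_sub => i a; exact: cells_cat. Qed.

Lemma cells_cons mem i a s u :
  cell mem i a -> cells mem s u -> cells mem (i :: s) (a :: u).
Proof. by constructor. Qed.

Lemma rows_cons mem s u rs (us : seq (seq R)) :
  cells mem s u -> rows mem rs us -> rows mem (s :: rs) (u :: us).
Proof. by constructor. Qed.

Local Hint Resolve cell_cat cells_cat rows_cat : core.

Lemma cell_nth mem i a : cell mem i a -> mem`_i = a.
Proof. exact: onth_nth. Qed.

Lemma cells_nth mem s u : cells mem s u -> [seq mem`_i | i <- s] = u.
Proof. by elim=> //= i a s' u' /cell_nth -> _ ->. Qed.

Lemma wp_ret {A} (a : A) mem c (Q : A -> seq R -> Prop) :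
  Q a mem -> wp (Ret a) mem c Q.
Proof. by []. Qed.

(** The continuation learns only that some cell holds the result, which keeps concrete addresses out
    of the later proofs. *)
Lemma wp_op {A} f (q : nat -> comp A) mem c a (Q : A -> seq R -> Prop) :
  eval_flop f mem = Some a ->
  (forall i ext, cell (mem ++ ext) i a -> wp (q i) (mem ++ ext) c Q) ->
  wp (Op f q) mem c.+1 Q.
Proof.
move=> /= -> wpq; rewrite -cats1; apply: wpq.
by rewrite /cell onth_cat ltnn subnn.
Qed.

Lemma wp_if {A} i j (q1 q2 : comp A) mem c a b (Q : A -> seq R -> Prop) :
  cell mem i a -> cell mem j b -> (a <= b -> wp q1 mem c Q) ->
  (b < a -> wp q2 mem c Q) -> wp (If i j q1 q2) mem c.+1 Q.
Proof.
by move=> /cell_nth /= -> /cell_nth -> wp1 wp2; case: leP => [/wp1|/wp2].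
Qed.

Arguments wp : simpl never.

Lemma eval_const0 mem : eval_flop (Const 0) mem = Some 0.
Proof. by rewrite /= rmorph0. Qed.

Lemma eval_add mem i j a b :
  cell mem i a -> cell mem j b -> eval_flop (Add i j) mem = Some (a + b).
Proof. by move=> /cell_nth /= -> /cell_nth ->. Qed.

Lemma eval_sub mem i j a b :
  cell mem i a -> cell mem j b -> eval_flop (Defs.Sub i j) mem = Some (a - b).
Proof. by move=> /cell_nth /= -> /cell_nth ->. Qed.

Lemma eval_mul mem i j a b :
  cell mem i a -> cell mem j b -> eval_flop (Mul i j) mem = Some (a * b).
Proof. by move=> /cell_nth /= -> /cell_nth ->. Qed.

Lemma eval_div mem i j a b : cell mem i a -> cell mem j b -> b != 0 ->
  eval_flop (Div i j) mem = Some (a / b).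
Proof. by move=> /cell_nth /= -> /cell_nth -> /negbTE ->. Qed.

Lemma eval_sqrt mem i a : cell mem i a -> 0 <= a ->
  eval_flop (Sqrt i) mem = Some (Num.sqrt a).
Proof. by move=> /cell_nth /= ->; rewrite leNgt => /negbTE ->. Qed.

(** Stability of r and r' under extension keeps the facts about pending inputs and earlier results
    while further elements are processed; n bounds the cost per element. *)
Lemma wp_mapM {A B V W} (f : A -> comp B) (g : V -> W) (n c : nat)
    (r : seq R -> A -> V -> Prop) (r' : seq R -> B -> W -> Prop) mem s t :
  (forall mem ext a x, r mem a x -> r (mem ++ ext) a x) ->
  (forall mem ext b y, r' mem b y -> r' (mem ++ ext) b y) ->
  (forall ext a x, r (mem ++ ext) a x ->
    wp (f a) (mem ++ ext) n (fun b mem' => r' mem' b (g x))) ->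
  List.Forall2 (r mem) s t -> (size t * n <= c)%N ->
  wp (mapM f s) mem c (fun bs mem' => List.Forall2 (r' mem') bs (map g t)).
Proof.
move=> rcat rcat' wpf st tc.
suff H ext : wp (mapM f s) (mem ++ ext) (size t * n)
    (fun bs mem' => List.Forall2 (r' mem') bs (map g t)).
  by have := H [::]; rewrite cats0 => /wp_weaken; apply.
elim: st ext {tc} => {s t} [|a x s t ax _ IH] ext; first by constructor.
apply: (wp_bind (c1 := n) (c2 := size t * n)).
- by apply: (wpf _ _ x); exact: rcat.
- by rewrite /= mulSn.
move=> b ext1 rb; rewrite -catA.
apply: (wp_bind (c1 := size t * n) (c2 := 0)) (IH _) _ _.
  by rewrite addn0.
move=> bs ext2 rbs; apply: wp_ret; constructor => //=.
by apply: rcat'; rewrite catA.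
Qed.

Fixpoint dotv u v : R :=
  match u, v with
  | a :: u', b :: v' => a * b + dotv u' v'
  | _, _ => 0
  end.

(** The cost is a product and a sum per entry, plus one operation for the initial zero. *)
Lemma wp_dotp mem s t u v c : cells mem s u -> cells mem t v ->
  ((size u).*2.+1 <= c)%N ->
  wp (dotp s t) mem c (fun i mem' => cell mem' i (dotv u v)).
Proof.
elim: s u t v mem c => [|i s IH] u t v mem c.
  move=> /Forall2_nill -> _; case: c => // c _.
  by apply: (wp_op (eval_const0 mem)).
move=> /Forall2_consl[a [u' [-> ia su]]]; case: t => [|j t].
  move=> /Forall2_nill ->; case: c => // c _.
  by apply: (wp_op (eval_const0 mem)).
move=> /Forall2_consl[b [v' [-> jb tv]]]; case: c => // c.
rewrite /= doubleS ltnS => uc.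
apply: (wp_op (eval_mul ia jb)) => k ext ck.
apply: (wp_bind (c1 := (size u').*2.+1) (c2 := 1)).
- exact: (IH _ _ _ _ _ (cells_cat _ su) (cells_cat _ tv) (leqnn _)).
- by rewrite addn1.
move=> l ext1 cl; apply: (wp_op (eval_add (cell_cat _ ck) cl)) => m ext2 cm.
exact: cm.
Qed.

Lemma wp_affp mem s j t u a v c : cells mem s u -> cell mem j a ->
  cells mem t v -> ((size u).*2.+2 <= c)%N ->
  wp (affp t (s, j)) mem c (fun i mem' => cell mem' i (dotv u v + a)).
Proof.
move=> su ja tv uc; apply: (wp_bind (c1 := (size u).*2.+1) (c2 := 1)).
- exact: (wp_dotp su tv (leqnn _)).
- by rewrite addn1.
move=> i ext ci; apply: (wp_op (eval_add ci (cell_cat _ ja))) => k ext1 ck.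
exact: ck.
Qed.

Lemma wp_mulp mem rs cs us vs n c : rows mem rs us -> rows mem cs vs ->
  (forall u, u \in us -> size u = n) ->
  (size us * (size vs * n.*2.+1) <= c)%N ->
  wp (mulp rs cs) mem c
    (fun ws mem' => rows mem' ws [seq [seq dotv u v | v <- vs] | u <- us]).
Proof.
move=> rus cvs sus uc.
pose r mem s u := cells mem s u /\ size u = n.
have {}rus : List.Forall2 (r mem) rs us.
  elim: rus sus {uc} => [|s u {}rs {}us su _ IH] sus; constructor.
    by split=> //; apply: sus; rewrite mem_head.
  by apply: IH => w wus; apply: sus; rewrite inE wus orbT.
apply: (@wp_mapM _ _ _ _ _ _ _ _ r cells _ _ _ _ _ _ rus uc) => //.
- by move=> mem' ext s u [su un]; split => //; exact: cells_cat.
- exact: cells_cat.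
move=> ext s u [su un].
apply: (@wp_mapM _ _ _ _ _ _ n.*2.+1 _ cells cell) (leqnn _) => //.
- exact: cells_cat.
- exact: cell_cat.
- move=> ext1 t v tv; apply: wp_dotp => //; first exact: cells_cat.
  by rewrite un.
- exact: rows_cat cvs.
Qed.

Definition cell2 mem (i : nat * nat) (a : R * R) : Prop :=
  cell mem i.1 a.1 /\ cell mem i.2 a.2.

Lemma cell2_cat mem ext i a : cell2 mem i a -> cell2 (mem ++ ext) i a.
Proof. by move=> [? ?]; split; exact: cell_cat. Qed.

Lemma cells_zip mem s t u v : cells mem s u -> cells mem t v ->
  List.Forall2 (cell2 mem) (zip s t) (zip u v).
Proof. exact: Forall2_zip. Qed.

Lemma cells_unzip1 mem s us :
  List.Forall2 (cell2 mem) s us -> cells mem (unzip1 s) (unzip1 us).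
Proof. by move=> h; apply: Forall2_map; apply: Forall2_sub h => i a []. Qed.

Lemma cells_unzip2 mem s us :
  List.Forall2 (cell2 mem) s us -> cells mem (unzip2 s) (unzip2 us).
Proof. by move=> h; apply: Forall2_map; apply: Forall2_sub h => i a []. Qed.

Lemma wp_rotp mem i j ij c s ab : cell mem i c -> cell mem j s ->
  cell2 mem ij ab ->
  wp (rotp i j ij) mem 6 (fun kl mem' =>
    cell2 mem' kl (c * ab.1 + s * ab.2, c * ab.2 - s * ab.1)).
Proof.
move=> ci cj [ca cb]; rewrite /rotp.
apply: (wp_op (eval_mul ci ca)) => i1 e1 c1.
apply: (wp_op (eval_mul (cell_cat _ cj) (cell_cat _ cb))) => i2 e2 c2.
apply: (wp_op (eval_mul (a := c) (b := ab.2) _ _)); do ?[auto 20] => i3 e3 c3.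
apply: (wp_op (eval_mul (a := s) (b := ab.1) _ _)); do ?[auto 20] => i4 e4 c4.
apply: (wp_op (eval_add (a := c * ab.1) (b := s * ab.2) _ _)); do ?[auto 20] => i5 e5 c5.
apply: (wp_op (eval_sub (a := c * ab.2) (b := s * ab.1) _ _)); do ?[auto 20] => i6 e6 c6.
apply: wp_ret; split => /=; auto 20.
Qed.

(* The squared norm of the product with x of the upper triangular matrix whose
   rows, from the diagonal on, are rs. *)
Fixpoint quad (rs : seq (seq R)) (x : seq R) : R :=
  if rs is r :: rs' then dotv r x ^+ 2 + quad rs' (behead x) else 0.

Fixpoint tri (n : nat) (rs : seq (seq R)) : bool :=
  match n, rs with
  | 0, [::] => true
  | n'.+1, r :: rs' => (size r == n) && tri n' rs'
  | _, _ => false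
  end.

(** Both rows produced by a rotation have this form, with coefficients (cos, sin) and (-sin,
    cos). *)
Lemma dotv_lincomb (f : R * R -> R) c s u v x : size u = size v ->
  (forall a b, f (a, b) = c * a + s * b) ->
  dotv [seq f ab | ab <- zip u v] x = c * dotv u x + s * dotv v x.
Proof.
move=> + fE; elim: u v x => [|a u IH] [|b v] [|y x]//=; rewrite ?mulr0 ?addr0//.
by move=> [uv]; rewrite IH// fE; ring.
Qed.

(** The rotation with cosine a / n and sine b / n maps (a x + p, b x + q) to the pair on the left,
    whose second component is free of x. Here x is the coordinate of the pivot column, and p, q
    collect the others. *)
Lemma givens_quad (a b p q x : R) : let n := Num.sqrt (a * a + b * b) in
  0 < a * a + b * b ->
  (n * x + (a / n * p + b / n * q)) ^+ 2 + (a / n * q - b / n * p) ^+ 2 =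
  (a * x + p) ^+ 2 + (b * x + q) ^+ 2.
Proof.
move=> n n2_gt0; have n0 : n != 0 by rewrite gt_eqF// sqrtr_gt0.
have nn : n ^+ 2 = a * a + b * b by rewrite sqr_sqrtr// ltW.
have aE : a = n * (a / n) by rewrite mulrC divfK.
have bE : b = n * (b / n) by rewrite mulrC divfK.
have cs : (a / n) ^+ 2 + (b / n) ^+ 2 = 1.
  by rewrite !expr_div_n -mulrDl nn divff// gt_eqF.
move: aE bE cs {nn}; set c := a / n; set s := b / n => -> -> cs.
have e1 : (c * p + s * q) ^+ 2 + (c * q - s * p) ^+ 2 = p ^+ 2 + q ^+ 2.
  by rewrite -[RHS]mul1r -cs; ring.
have e2 : (c ^+ 2 + s ^+ 2) * (n ^+ 2 * x ^+ 2) = n ^+ 2 * x ^+ 2.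
  by rewrite cs mul1r.
lra.
Qed.

(** Each of the n levels spends at most seven operations on the pivots (two products, a sum, a
    comparison, a root, two divisions) and six on each of the fewer than n remaining pairs. *)
Lemma wp_givensp z rs (v : seq nat) mem us w n c :
  rows mem rs us -> cells mem v w -> tri n us -> size w = n -> cell mem z 0 ->
  (n * (6 * n + 7) <= c)%N ->
  wp (givensp z rs v) mem c (fun rs' mem' => exists us',
    [/\ rows mem' rs' us', tri n us' &
        forall x, size x = n -> quad us' x = quad us x + dotv w x ^+ 2]).
Proof.
elim: n rs us v w mem c => [|n IH] [|s rs] us v w mem c.
- move=> /Forall2_nill -> _ _ /size0nil -> _ _.
  case: v => [|j v]; apply: wp_ret; exists [::]; split;
    by [constructor|move=> x _; rewrite expr0n/= addr0].
- by move=> /Forall2_consl[u [us' [-> _ _]]].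
- by move=> /Forall2_nill ->.
move=> /Forall2_consl[u [us' [{us}-> su rus]]] /= vw /andP[/eqP un tri_us] wn z0.
case: u un su => [//|a u] [un]; case: s => [/Forall2_nill//|i s].
move=> /Forall2_consl[a' [u' [[<- <-] {a' u'} ia su]]].
case: w wn vw => [//|b w] [wn]; case: v => [/Forall2_nill//|j v].
move=> /Forall2_consl[b' [w' [[<- <-] {b' w'} jb vw]]] nc.
have {}rus : rows mem rs us' := rus.
have {}su : cells mem s u := su.
have {}vw : cells mem v w := vw.
have {}nc : (3 + (1 + (3 + (6 * n + n * (6 * n + 7)))) <= c)%N by lia.
apply: (wp_weaken _ nc (fun _ _ h => h)) => {c nc}; rewrite /givensp -/givensp.
apply: (wp_op (eval_mul ia ia)) => aa e1 c1.
apply: (wp_op (eval_mul (a := b) (b := b) _ _)); do ?[auto 20] => bb e2 c2.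
apply: (wp_op (eval_add (a := a * a) (b := b * b) _ _)); do ?[auto 20] => nn e3 c3.
apply: (wp_if (b := 0) c3); first by auto 20.
  move=> ab0; have [a0 b0] : a = 0 /\ b = 0.
    have := sqr_ge0 a; have := sqr_ge0 b; rewrite !expr2 => bb0 aa0.
    have /eqP : a * a = 0 by lra.
    have /eqP : b * b = 0 by lra.
    by rewrite !mulf_eq0 !orbb => /eqP -> /eqP ->.
  apply: (wp_bind (c1 := n * (6 * n + 7)) (c2 := 0)).
  - by apply: (IH rs us' v w) => //; auto 20.
  - by lia.
  move=> rs' ext [us'' [rus'' tri_us'' quadE]]; apply: wp_ret.
  exists ((a :: u) :: us''); split => /=.
  - by apply: rows_cons => //; apply: cells_cons; auto 20.
  - by rewrite un eqxx.
  case=> [//|y x] [xn] /=; rewrite quadE// a0 b0; ring.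
move=> ab0.
apply: (wp_op (eval_sqrt c3 (ltW ab0))) => k e4 c4.
have k0 : Num.sqrt (a * a + b * b) != 0 by rewrite gt_eqF// sqrtr_gt0.
apply: (wp_op (eval_div (a := a) _ c4 k0)); do ?[auto 20] => cos e5 c5.
apply: (wp_op (eval_div (a := b) (b := Num.sqrt (a * a + b * b)) _ _ k0));
  do ?[auto 20] => sin e6 c6.
set Ca := a / _ in c5; set Sb := b / _ in c6.
apply: (wp_bind (c1 := 6 * n) (c2 := n * (6 * n + 7))) => //.
- apply: (@wp_mapM _ _ _ _ _ (fun ab => (Ca * ab.1 + Sb * ab.2, Ca * ab.2 - Sb * ab.1))
    6 _ cell2 cell2 _ (zip s v) (zip u w)).
  + exact: cell2_cat.
  + exact: cell2_cat.
  + by move=> ext x y xy; apply: wp_rotp => //; auto 20.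
  + by apply: cells_zip; auto 20.
  + by rewrite size_zip un wn minnn mulnC.
move=> ps e7 rps.
have ps1 := cells_unzip1 rps; have ps2 := cells_unzip2 rps.
rewrite /unzip1 -map_comp in ps1; rewrite /unzip2 -map_comp in ps2.
apply: (wp_bind (c1 := n * (6 * n + 7)) (c2 := 0)).
- apply: (IH rs us' (unzip2 ps) [seq Ca * ab.2 - Sb * ab.1 | ab <- zip u w]) => //.
  + by auto 20.
  + by rewrite size_map size_zip un wn minnn.
  + by auto 20.
- by rewrite addn0.
move=> rs' e8 [us'' [rus'' tri_us'' quadE]]; apply: wp_ret.
exists ((Num.sqrt (a * a + b * b) ::
  [seq Ca * ab.1 + Sb * ab.2 | ab <- zip u w]) :: us'').
split => /=.
- apply: rows_cons => //; apply: cells_cons; auto 20.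
- by rewrite size_map size_zip un wn minnn eqxx.
case=> [//|y x] [xn] /=; rewrite quadE//.
rewrite (dotv_lincomb (c := Ca) (s := Sb))//; last by rewrite un.
rewrite (dotv_lincomb (c := - Sb) (s := Ca)); last 2 first.
- by rewrite un.
- by move=> a1 b1 /=; ring.
have := givens_quad (dotv u x) (dotv w x) y ab0; rewrite -/Ca -/Sb => gq.
lra.
Qed.

Lemma wp_qrp z rs vs mem us (ws : seq (seq R)) n c :
  rows mem rs us -> rows mem vs ws -> tri n us ->
  (forall w, w \in ws -> size w = n) -> cell mem z 0 ->
  (size ws * (n * (6 * n + 7)) <= c)%N ->
  wp (qrp z rs vs) mem c (fun rs' mem' => exists us',
    [/\ rows mem' rs' us', tri n us' &
        forall x, size x = n ->
          quad us' x = quad us x + \sum_(w <- ws) dotv w x ^+ 2]).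
Proof.
elim: vs rs us ws mem c => [|v vs IH] rs us ws mem c.
  move=> rus /Forall2_nill -> tri_us _ _ _; apply: wp_ret; exists us; split => //.
  by move=> x _; rewrite big_nil addr0.
move=> rus /Forall2_consl[w [ws' [-> vw vws]]] tri_us wn z0 wc.
have {}vws : rows mem vs ws' := vws.
apply: wp_bind (wp_givensp rus vw tri_us _ z0 (leqnn _)) wc _.
  by apply: wn; rewrite mem_head.
move=> rs' ext [us' [rus' tri_us' quadE]]; rewrite -/qrp.
apply: (wp_weaken (IH rs' us' ws' _ _ rus' _ tri_us' _ _ (leqnn _))) => //.
- by auto.
- by move=> w' w'ws; apply: wn; rewrite inE w'ws orbT.
- by auto.
move=> rs'' ext' [us'' [rus'' tri_us'' quadE']]; exists us''; split => // x xn.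
by rewrite quadE'// quadE// big_cons addrA.
Qed.

Lemma rows_zero mem z n :
  cell mem z 0 -> rows mem (zero_rows z n) (zero_rows 0 n).
Proof.
move=> z0; have cells_nseq k : cells mem (nseq k z) (nseq k 0).
  by elim: k => [|k IH]; constructor.
elim: n => [|n IH]; first by constructor.
by apply: rows_cons => //; exact: (cells_nseq n.+1).
Qed.

Lemma tri_zero n : tri n (zero_rows 0 n).
Proof. by elim: n => //= n ->; rewrite size_nseq eqxx. Qed.

Lemma quad_zero n x : quad (zero_rows 0 n) x = 0.
Proof.
have dot0 m : forall y, dotv (nseq m 0) y = 0.
  by elim: m => [|m IH] [|b y]//=; rewrite IH mul0r addr0.
elim: n x => [//|n IH] x.
rewrite -[LHS]/(dotv (nseq n.+1 0) x ^+ 2 + quad (zero_rows 0 n) (behead x)).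
by rewrite IH dot0 addr0 expr0n.
Qed.

Lemma tri_size n us i : tri n us -> (i < n)%N -> size (nth [::] us i) = (n - i)%N.
Proof.
elim: n us i => [//|n IH] [//|u us] [|i] /= /andP[/eqP un tri_us] //.
by rewrite ltnS subSS; exact: IH.
Qed.

Lemma quad_sum n us x : tri n us -> size x = n ->
  quad us x = \sum_(i < n) dotv (nth [::] us i) (drop i x) ^+ 2.
Proof.
elim: n us x => [|n IH] [|u us] x //=; first by rewrite big_ord0.
case: x => [//|a x] /andP[_ tri_us] [xn]; rewrite big_ord_recl/= IH//.
Qed.

Lemma dotv_sum u v : size u = size v ->
  dotv u v = \sum_(0 <= k < size u) u`_k * v`_k.
Proof.
elim: u v => [|a u IH] [|b v] //=; first by rewrite big_nil.
by move=> [uv]; rewrite big_nat_recl//= IH//.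
Qed.

Lemma dotv_map I (s : seq I) (f g : I -> R) :
  dotv [seq f i | i <- s] [seq g i | i <- s] = \sum_(i <- s) f i * g i.
Proof. by elim: s => [|i s IH] /=; rewrite ?big_nil ?big_cons ?IH. Qed.

Definition mat_rows m n (M : 'M[R]_(m, n)) : seq (seq R) :=
  [seq [seq M i j | j : 'I_n] | i : 'I_m].

Lemma entriesE m n (M : 'M[R]_(m, n)) : entries M = flatten (mat_rows M).
Proof. by []. Qed.

Lemma entries_cV n (u : 'cV[R]_n) : entries u = [seq u i 0 | i : 'I_n].
Proof.
have enum1 : enum 'I_1 = [:: 0].
  by apply: (inj_map val_inj); rewrite val_enum_ord.
by rewrite entriesE /mat_rows /image_mem enum1 flatten_map1.
Qed.

Lemma mat_rows_size m n (M : 'M[R]_(m, n)) w : w \in mat_rows M -> size w = n.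
Proof. by move=> /mapP[i _ ->]; rewrite size_image card_ord. Qed.

Lemma dotv_row m n (M : 'M[R]_(m, n)) (u : 'cV[R]_n) i :
  dotv [seq M i j | j : 'I_n] (entries u) = (M *m u) i 0.
Proof. by rewrite entries_cV dotv_map mxE big_enum. Qed.

Lemma mat_rows_mul m n k (M : 'M[R]_(m, n)) (N : 'M[R]_(n, k)) :
  [seq [seq dotv u v | v <- mat_rows N^T] | u <- mat_rows M] = mat_rows (M *m N).
Proof.
rewrite -map_comp; apply: eq_map => i /=; rewrite -map_comp; apply: eq_map => j /=.
rewrite dotv_map mxE big_enum/=; apply: eq_bigr => l _; by rewrite mxE.
Qed.

Lemma sum_dotv_rows m n (M : 'M[R]_(m, n)) (u : 'cV[R]_n) :
  \sum_(w <- mat_rows M) dotv w (entries u) ^+ 2 =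
  ((M *m u)^T *m (M *m u)) 0 0.
Proof.
rewrite big_map big_enum/= [RHS]mxE; apply: eq_bigr => i _.
by rewrite dotv_row [in RHS]mxE expr2.
Qed.

Definition upper_mx n (us : seq (seq R)) : 'M[R]_n :=
  \matrix_(i, j) if (i <= j)%N then (nth [::] us i)`_(j - i) else 0.

(** Row i, stored from the diagonal on, meets the vector without its first i entries; adding the
    zeros left of the diagonal gives the full matrix product. *)
Lemma quad_upper_mx n us (u : 'cV[R]_n) : tri n us ->
  quad us (entries u) =
  ((upper_mx n us *m u)^T *m (upper_mx n us *m u)) 0 0.
Proof.
move=> tri_us; have un : size (entries u) = n.
  by rewrite entries_cV size_image card_ord.
rewrite (quad_sum tri_us un) [RHS]mxE; apply: eq_bigr => i _.
rewrite [in RHS]mxE -expr2; congr (_ ^+ 2); rewrite mxE.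
rewrite dotv_sum; last by rewrite size_drop un (tri_size tri_us).
rewrite (tri_size tri_us)//.
pose f k := (if (i <= k)%N then (nth [::] us i)`_(k - i) else 0) * (entries u)`_k.
transitivity (\sum_(0 <= k < n) f k).
  rewrite (big_cat_nat (leq0n i) (ltnW (ltn_ord i)))/=.
  rewrite [X in _ = X + _]big_nat [X in _ = X + _]big1 ?add0r;
    last first => [k /andP[_ ki]|].
    by rewrite /f leqNgt ki mul0r.
  rewrite -[X in _ = \sum_(X <= _ < _) _]add0n big_addn; apply: eq_bigr => k _.
  by rewrite /f leq_addl addnK nth_drop [(i + k)%N]addnC.
rewrite big_mkord; apply: eq_bigr => k _.
rewrite /f mxE entries_cV (nth_map k) ?size_enum_ord//.
by rewrite nth_ord_enum.
Qed.

End correctness.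

(** * Memory layout and the complete update *)

Section update_correct.
Context {R : realType}.
Local Hint Resolve cell_cat cells_cat rows_cat : core.

Lemma entries_size m n (M : 'M[R]_(m, n)) : size (entries M) = (m * n)%N.
Proof. by rewrite size_allpairs !size_enum_ord. Qed.

Lemma onth_flatten (T : Type) (ss : seq (seq T)) n i j :
  (forall k, (k < size ss)%N -> size (nth [::] ss k) = n) ->
  (i < size ss)%N -> (j < n)%N ->
  onth (flatten ss) (i * n + j) = onth (nth [::] ss i) j.
Proof.
elim: ss i => [//|s ss IH] [|i] sn /= iss jn; rewrite onth_cat (sn 0%N)//.
  by rewrite mul0n add0n jn.
rewrite mulSn -addnA ltnNge leq_addr/= addKn IH// => k kss.
exact: (sn k.+1).
Qed.

Lemma cell_entries m n (M : 'M[R]_(m, n)) (pre post : seq R) off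
    (i : 'I_m) (j : 'I_n) :
  size pre = off -> cell (pre ++ entries M ++ post) (off + (i * n + j)) (M i j).
Proof.
move=> <-; rewrite /cell onth_cat ltnNge leq_addr/= addKn.
apply: cell_cat; rewrite /cell entriesE.
have szr k : (k < size (mat_rows M))%N -> size (nth [::] (mat_rows M) k) = n.
  by move=> /(mem_nth [::]) /mat_rows_size.
rewrite (onth_flatten szr) ?ltn_ord//; last by rewrite size_map size_enum_ord.
rewrite (nth_map i) ?size_enum_ord// nth_ord_enum onth_map.
rewrite onthE (nth_map j) ?size_enum_ord// nth_ord_enum//.
Qed.

Lemma rows_at_cells n (M : 'M[R]_n) mem off :
  (forall i j : 'I_n, cell mem (off + (i * n + j)) (M i j)) ->
  rows mem (rows_at n off) (mat_rows M).
Proof.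
by move=> cM; apply: Forall2_map_same => i; apply: Forall2_map_same => j.
Qed.

Lemma cols_at_cells n (M : 'M[R]_n) mem off :
  (forall i j : 'I_n, cell mem (off + (i * n + j)) (M i j)) ->
  rows mem (cols_at n off) (mat_rows M^T).
Proof.
move=> cM; apply: Forall2_map_same => i; apply: Forall2_map_same => j.
by rewrite mxE.
Qed.

Lemma vec_at_cells n (u : 'cV[R]_n) mem off :
  (forall (i : 'I_n) (j : 'I_1), cell mem (off + (i * 1 + j)) (u i j)) ->
  cells mem (vec_at n off) (entries u).
Proof.
move=> cu; rewrite entries_cV; apply: Forall2_map_same => i.
by have := cu i 0; rewrite muln1 addn0.
Qed.

Lemma rows_flatten (mem : seq R) ss us :
  rows mem ss us -> cells mem (flatten ss) (flatten us).
Proof. by elim=> [|s u ss' us' su _ IH] /=; [constructor|exact: Forall2_cat]. Qed.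

Lemma lower_cells_upper_mx n mem z rs us : cell mem z 0 -> rows mem rs us ->
  cells mem (lower_cells n z rs) (entries (@upper_mx R n us)^T).
Proof.
move=> z0 rus.
suff : rows mem [seq [seq if j <= i then nth z (nth [::] rs j) (i - j) else z
    | j : 'I_n] | i : 'I_n]%N (mat_rows (@upper_mx R n us)^T).
  exact: rows_flatten.
apply: Forall2_map_same => i; apply: Forall2_map_same => j.
rewrite !mxE; case: ifP => // _.
by apply: Forall2_nth => //; apply: Forall2_nth => //; constructor.
Qed.

Lemma affine_entries m n (M : 'M[R]_(m, n)) (u : 'cV[R]_n) (v : 'cV[R]_m) :
  [seq dotv wa.1 (entries u) + wa.2 | wa <- zip (mat_rows M) (entries v)] =
  entries (M *m u + v).
Proof.
rewrite [entries v]entries_cV [RHS]entries_cV zip_map -map_comp.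
by apply: eq_map => i /=; rewrite dotv_row [RHS]mxE.
Qed.

(** The triangular factor is specified by its Gram matrix alone; [reduced_qr_of_gram] supplies the
    orthonormal factor afterwards. *)
Lemma wp_update_comp D (G L Gamma Lambda : 'M[R]_D) (p q : 'cV[R]_D) :
  (0 < D)%N ->
  wp (update_comp D)
    (entries G ++ entries p ++ entries L ++ entries Gamma ++ entries q ++
      entries Lambda)
    (37 * D ^ 3) (fun s mem => exists us : seq (seq R),
      let U := upper_mx D us in
      [/\ [seq mem`_i | i <- s] =
            entries (G *m Gamma) ++ entries (G *m q + p) ++ entries U^T &
          U^T *m U = (col_mx (Lambda^T *m G^T) L^T)^T *m
                     col_mx (Lambda^T *m G^T) L^T]).
Proof.
move=> D0; set mem := (X in wp _ X); rewrite /update_comp.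
have sM (M : 'M[R]_D) : size (entries M) = (D * D)%N by exact: entries_size.
have sV (u : 'cV[R]_D) : size (entries u) = D by rewrite entries_size muln1.
have cG (i j : 'I_D) : cell mem (0 + (i * D + j)) (G i j).
  exact: (@cell_entries _ _ G [::]).
have cp (i : 'I_D) (j : 'I_1) : cell mem (D * D + (i * 1 + j)) (p i j).
  exact: cell_entries.
have cL (i j : 'I_D) : cell mem (D * D + D + (i * D + j)) (L i j).
  have := @cell_entries _ _ L (entries G ++ entries p)
    (entries Gamma ++ entries q ++ entries Lambda) _ i j erefl.
  by rewrite -!catA !size_cat !sM !sV.
set oC := (D * D + D + D * D)%N.
have cC (i j : 'I_D) : cell mem (oC + (i * D + j)) (Gamma i j).
  have := @cell_entries _ _ Gamma (entries G ++ entries p ++ entries L)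
    (entries q ++ entries Lambda) _ i j erefl.
  by rewrite -!catA !size_cat !sM !sV !addnA.
have cq (i : 'I_D) (j : 'I_1) : cell mem (oC + D * D + (i * 1 + j)) (q i j).
  have := @cell_entries _ _ q (entries G ++ entries p ++ entries L ++ entries Gamma)
    (entries Lambda) _ i j erefl.
  by rewrite -!catA !size_cat !sM !sV !addnA.
have cM (i j : 'I_D) : cell mem (oC + D * D + D + (i * D + j)) (Lambda i j).
  have := @cell_entries _ _ Lambda
    (entries G ++ entries p ++ entries L ++ entries Gamma ++ entries q) [::]
    _ i j erefl.
  by rewrite -!catA cats0 !size_cat !sM !sV !addnA.
have smat (M : 'M[R]_D) : size (mat_rows M) = D by rewrite size_map size_enum_ord.
pose cmul := (D * (D * D.*2.+1))%N.
pose caff := (D * D.*2.+2)%N.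
pose cqr := ((D + D) * (D * (6 * D + 7)))%N.
(* The sum equals 16 D^3 + 18 D^2 + 2 D + 1, and 16 + 18 + 2 + 1 = 37. *)
have cost : (cmul + (caff + (cmul + (1 + (cqr + 0)))) <= 37 * D ^ 3)%N.
  have D1 : (D <= D * D)%N by rewrite leq_pmull.
  have D2 : (D * D <= D * (D * D))%N by rewrite leq_pmull.
  rewrite /cmul /caff /cqr -!muln2 !expnS expn0 muln1; clear -D0 D1 D2; nia.
apply: (wp_weaken _ cost (fun _ _ h => h)).
have rows_G := rows_at_cells cG.
apply: (wp_bind (wp_mulp rows_G (cols_at_cells cC) (@mat_rows_size _ _ _ G)
  (leqnn _))); first by rewrite !smat.
rewrite mat_rows_mul => GC ext1 rGC.
have aff : wp (mapM (affp (vec_at D (oC + D * D))) (zip (rows_at D 0) (vec_at D (D * D))))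
    (mem ++ ext1) caff (fun s mem => cells mem s
      [seq dotv ub.1 (entries q) + ub.2 | ub <- zip (mat_rows G) (entries p)]).
  pose r (mem : seq R) (si : seq nat * nat) (ua : seq R * R) :=
    [/\ cells mem si.1 ua.1, cell mem si.2 ua.2 & size ua.1 = D].
  apply: (@wp_mapM _ _ _ _ _ _ _ D.*2.+2 _ r cell).
  - by move=> m e [s i] [u a] [su ia un]; split => //; auto.
  - exact: cell_cat.
  - move=> e [s i] [u a] [su ia un]; apply: wp_affp su ia _ _; last by rewrite un.
    apply: cells_cat; apply: cells_cat; exact: vec_at_cells cq.
  - rewrite entries_cV zip_map zip_map; apply: Forall2_map_same => i.
    split; last by rewrite size_map size_enum_ord.
      by apply: Forall2_map_same => j; apply: cell_cat.
    by have := cell_cat ext1 (cp i 0); rewrite muln1 addn0.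
  - by rewrite size_zip smat sV minnn.
rewrite affine_entries in aff.
apply: (wp_bind aff (leqnn _)) => v ext2 cv.
have rowsT_G : rows mem (rows_at D 0) (mat_rows (G^T)^T) by rewrite trmxK.
have cols_M := cols_at_cells cM.
apply: (wp_bind (wp_mulp (c := cmul) (rows_cat _ (rows_cat _ cols_M))
  (rows_cat _ (rows_cat _ rowsT_G)) (@mat_rows_size _ _ _ _) _) (leqnn _)).
  by rewrite !smat.
rewrite mat_rows_mul => W ext3 rW.
apply: (wp_op (eval_const0 _)) => z ext4 z0.
have cols_L := cols_at_cells cL.
pose ws := mat_rows (Lambda^T *m G^T) ++ mat_rows L^T.
apply: (wp_bind (wp_qrp (c := cqr) (ws := ws) (rows_zero D z0) _ (tri_zero D) _ z0 _)
  (leqnn _)).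
- by apply: Forall2_cat; [exact: rows_cat|do 4 apply: rows_cat].
- by move=> w; rewrite mem_cat => /orP[] /mat_rows_size.
- by rewrite size_cat !smat.
move=> rs ext5 [us [rus tri_us quadE]]; apply: wp_ret; exists us; split.
  apply: cells_nth; apply: Forall2_cat; [|apply: Forall2_cat].
  - by apply: rows_flatten; do 4 apply: rows_cat.
  - by do 3 apply: cells_cat.
  - by apply: lower_cells_upper_mx => //; exact: cell_cat.
(* The rotations started from the zero matrix, so the quadratic form of the result is just the sum
   over the stacked rows. *)
apply: gram_of_norms => u; rewrite -quad_upper_mx// quadE ?sV// quad_zero add0r.
rewrite big_cat/= !sum_dotv_rows mul_col_mx tr_col_mx mul_row_col.
by rewrite [RHS]mxE.
Qed.

End update_correct.

Theorem mainTheorem2 (R : realType) :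
  (forall (d D K : nat) (hd : (0 < d)%N) (hD : (0 < D)%N) (hK : (0 < K)%N)
      (disp : measure_display) (T : measurableType disp) (P : probability T R)
      (A : nat -> 'M[R]_D) (H : nat -> 'M[R]_(d, D))
      (m0 : 'cV[R]_D) (C0 : 'M[R]_D) (B : nat -> 'M[R]_D) (S : nat -> 'M[R]_d)
      (theta : {RV P >-> 'cV[R]_D})
      (b : nat -> {RV P >-> 'cV[R]_D}) (r : nat -> {RV P >-> 'cV[R]_d})
      (x : nat -> {RV P >-> 'cV[R]_D}) (y : nat -> {RV P >-> 'cV[R]_d})
      (hssm : linear_gaussian_ssm K A H m0 C0 B S theta b r x y)
      (k : nat) (hk : (1 <= k <= K)%N)
      (G Gamma L Lambda : 'M[R]_D)
      (p : k.-2.-tuple 'cV[R]_d -> 'cV[R]_D)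
      (pi_ : k.-1.-tuple 'cV[R]_d -> 'cV[R]_D)
      (hp : measurable_fun [set: k.-2.-tuple 'cV[R]_d] p)
      (hpi : measurable_fun [set: k.-1.-tuple 'cV[R]_d] pi_)
      (hprev : cond_gaussian (x 0%N) (x k.-1) (obs_upto y k.-2) G p L)
      (hback : cond_gaussian (x k.-1) (x k) (obs_upto y k.-1) Gamma pi_ Lambda)
      (Q : 'M[R]_(D + D, D)) (Rf : 'M[R]_D)
      (hqr : reduced_qr Q Rf (col_mx (Lambda^T *m G^T) L^T)),
    cond_gaussian (x 0%N) (x k) (obs_upto y k.-1)
      (G *m Gamma) (fun ys => G *m pi_ ys + p (obs_prev ys)) Rf^T)
  /\
  (exists (algo : nat -> program) (c : nat), forall (D : nat), (0 < D)%N ->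
    forall (G L Gamma Lambda : 'M[R]_D) (p pi_ : 'cV[R]_D),
    exists (Q : 'M[R]_(D + D, D)) (Rf : 'M[R]_D) (cost : nat),
      [/\ reduced_qr Q Rf (col_mx (Lambda^T *m G^T) L^T),
          run (algo D) (entries G ++ entries p ++ entries L ++
                        entries Gamma ++ entries pi_ ++ entries Lambda) =
            Some (entries (G *m Gamma) ++ entries (G *m pi_ + p) ++
                  entries Rf^T, cost)
        & (cost <= c * D ^ 3)%N]).
Proof.
split.
  (* Writing k as n + 1 makes [k.-1] and [k.-2] compute to n and [n.-1]. *)
  move=> d D K _ _ _ disp T P A H m0 C0 B S theta b r x y hssm [|n] /andP[k0 nK].
    case: (notF k0).
  move=> {k0} G Gamma L Lambda p q _ _ hprev hback Q Rf hqr.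
  apply: (ssm_cond_gaussian_step hssm nK hprev hback).
  rewrite trmxK (reduced_qr_gram hqr) tr_col_mx mul_row_col trmxK.
  by rewrite trmx_mul !trmxK !mulmxA.
exists update_algo, 37%N => D D0 G L Gamma Lambda p q.
have [s [mem [cost [runE [us [outE gram]] cost_le]]]] :=
  wp_run (wp_update_comp G L Gamma Lambda p q D0).
have upper (i j : 'I_D) : (j < i)%N -> upper_mx D us i j = 0.
  by move=> ji; rewrite mxE leqNgt ji.
have [Q hqr] := reduced_qr_of_gram gram upper.
exists Q, (upper_mx D us), cost; split => //.
rewrite -outE -runE /update_algo; congr (run (compile _ _) _).
by rewrite !size_cat !entries_size; lia.
Qed.
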